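(* Let $M$ be a compact 3-manifold with torus boundary, $\mathcal T$ an ordered ideal triangulation of the interior of $M$ with $N$ tetrahedra, $\pi=\pi_1(M)$, and $\alpha:\pi\to\mathbb Z$ a group homomorphism such that the cellular chain complex of $M$ with local coefficients twisted by $\alpha$ is acyclic, so that the Alexander polynomial $\Delta_\alpha(t)$ associated with $\alpha$ is defined. Let $\mathbf B\in M_{N\times N}(\mathbb Z[\pi])$ be the twisted Neumann--Zagier matrix of $\mathcal T$ and let $\mathbf B_\alpha(t)=\alpha(\mathbf B)\in M_{N\times N}(\mathbb Z[t^{\pm1}])$ be the matrix obtained by replacing each $\gamma\in\pi$ by $t^{\alpha(\gamma)}$. Then either $\det\mathbf B_\alpha(t)=0$ or $$\det \mathbf B_\alpha(t)\doteq \frac{\Delta_\alpha(t)}{t-1}\,(t^n-1)^m$$ for some integers $n\ge 0$ and $m\ge 1$, where $\doteq$ denotes equality up to multiplication by $\pm t^k$, $k\in\mathbb Z$.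
   Context: $M$ is connected and oriented, $\partial M$ is a torus. Ideal triangulation: $\mathcal T$ presents the interior of $M$ as finitely many tetrahedra with vertices removed, with faces identified in pairs. It has tetrahedra $\Delta_1,\dots,\Delta_N$ and equally many edges $e_1,\dots,e_N$. $\mathcal T$ is ordered if the vertices of each tetrahedron are labeled by $0,1,2,3$ and every face-pairing respects the vertex-order. Shape parameters: each edge of $\Delta_j$ is assigned one of $z_j,z_j',z_j''$, opposite edges having the same parameter, the three pairs of opposite edges getting the three different parameters. For ordered $\mathcal T$, the edges $(01)$ and $(23)$ of $\Delta_j$ get $z_j$; the other two pairs get $z_j',z_j''$ so that around each vertex the cyclic order $z_j\to z_j'\to z_j''$ follows one fixed convention with respect to the orientation of $M$. Twisted Neumann--Zagier matrix: let $\widetilde{\mathcal T}$ be the ideal triangulation of the universal cover induced by $\mathcal T$, on which $\pi$ acts on the left by deck transformations. Choose lifts $\widetilde e_i$ of $e_i$ and $\widetilde\Delta_j$ of $\Delta_j$. For $\square\in\{\ ,',''\}$ and $\gamma\in\pi$, let $G^\square_\gamma$ be the $N\times N$ integer matrix whose $(i,j)$-entry is the number of edges of $\gamma\cdot\widetilde\Delta_j$ assigned to $z_j^\square$ and identified with $\widetilde e_i$ in $\widetilde{\mathcal T}$. Put $\mathbf G^\square=\sum_{\gamma\in\pi}G^\square_\gamma\otimes\gamma\in M_{N\times N}(\mathbb Z[\pi])$ (a finite sum) and $\mathbf B=\mathbf G''-\mathbf G'$. Changing lifts multiplies $\mathbf B$ on the left and right by diagonal matrices with entries in $\pi$, so $\det\mathbf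 B_\alpha(t)$ is well defined up to $\pm t^k$. Alexander polynomial: let $\mathcal D$ be the 2-dimensional cell complex dual to $\mathcal T$ (one vertex per tetrahedron, one edge per face, one 2-cell per edge of $\mathcal T$), onto which $M$ deformation retracts. The cellular chain complex of the universal cover of $\mathcal D$ is a complex of free left $\mathbb Z[\pi]$-modules of ranks $N,2N,N$ in degrees $2,1,0$. Using bases given by lifts of cells, write the boundary maps as matrices acting on row vectors from the right and apply $\gamma\mapsto t^{\alpha(\gamma)}$ to get $P_2\in M_{N\times 2N}(\mathbb Z[t^{\pm1}])$ and $P_1\in M_{2N\times N}(\mathbb Z[t^{\pm1}])$, $P_2P_1=0$. Acyclic means acyclic over $\mathbb Q(t)$, i.e. $P_1,P_2$ both have rank $N$ over $\mathbb Q(t)$. Then $\Delta_\alpha(t)$ is defined, up to $\doteq$, by letting $\Delta_\alpha(t)/(t-1)$ be the torsion of this complex: $$\frac{\Delta_\alpha(t)}{t-1}\doteq\frac{\det\begin{pmatrix}P_2\\ b\end{pmatrix}}{\det(bP_1)}$$ for any $b\in M_{N\times 2N}(\mathbb Z[t^{\pm1}])$ with $\det(bP_1)\ne0$ (independent of $b$). For a knot complement in a homology sphere with $\alpha$ the abelianization this is the classical Alexander polynomial. *)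

(* Defs.v *)
From HB Require Import structures.
From Stdlib Require Import Relation_Operators.
From mathcomp Require Import all_boot all_order all_algebra perm.
From mathcomp Require Import boolp classical_sets functions cardinality fsbigop.

Set Implicit Arguments.
Unset Strict Implicit.
Unset Printing Implicit Defensive.

Import GRing.Theory.
Local Open Scope ring_scope.

(* ------------------------------------------------------------------------ *)
(** * Ideal triangulations *)

(* A family of tetrahedra indexed by [X], each with its vertices labelled by
   ['I_4], and whose faces are identified in pairs.  The face of [x] opposite
   to the vertex [a] is glued to a face of [adj x a].  The map [gperm x a]
   sends each of the three vertices of that face to the vertex it is glued to;
   it is extended to a permutation of ['I_4] by sending [a] to the vertex of
   [adj x a] opposite to the target face. *)
Record triangulation (X : Type) := Triangulation {
  adj : X -> 'I_4 -> X;
  gperm : X -> 'I_4 -> 'S_4;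
  adjK : forall x a, adj (adj x a) (gperm x a a) = x;
  gpermK : forall x a, gperm (adj x a) (gperm x a a) = (gperm x a)^-1%g;
  face_free : forall x a, ~ (adj x a = x /\ gperm x a a = a)
}.

Section Triangulation.
Variables (X : Type) (T : triangulation X).

Definition ordered := forall x (a u v : 'I_4),
  u != a -> v != a -> (u < v)%N -> (gperm T x a u < gperm T x a v)%N.

(* [o x] says whether the orientation of the tetrahedron [x] given by the order
   of its vertices 0, 1, 2, 3 is the one induced by the ambient orientation.
   Neighbours with the same sign must be glued by an orientation reversing
   relabelling (the mirror image in the common face preserves labels). *)
Definition oriented (o : X -> bool) := forall x a,
  odd_perm (gperm T x a) = (o x == o (adj T x a)).

(* [walk x w] is the end of the path of tetrahedra that starts at [x] and
   crosses successively the faces opposite to the vertices listed in [w]. *)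
Definition walk (x : X) (w : seq 'I_4) : X := foldl (adj T) x w.

Definition connected := forall x y, exists w, walk x w = y.

(* An edge of the tetrahedron [x] is [(x, e)] with [e] a pair of vertices. *)
Inductive edge_glue : X * {set 'I_4} -> X * {set 'I_4} -> Prop :=
  EdgeGlue x (a : 'I_4) (e : {set 'I_4}) : a \notin e ->
    edge_glue (x, e) (adj T x a, gperm T x a @: e).

Definition same_edge := clos_refl_sym_trans _ edge_glue.

(* Turning around an edge: [(x, c, d)] stands for the edge of [x] opposite to
   the edge [cd], leaving [x] through the face opposite to [c], after having
   entered it through the face opposite to [d].  The orbits of [turn] on the
   triples with [c != d] are the edges of the triangulation endowed with a
   direction of rotation, that is, the oriented 2-cells of the dual complex. *)
Definition turn (f : X * 'I_4 * 'I_4) : X * 'I_4 * 'I_4 :=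
  let: (x, c, d) := f in (adj T x c, gperm T x c d, gperm T x c c).

Lemma turn_inj : injective turn.
Proof.
have K x c : (gperm T (adj T x c) (gperm T x c c)) (gperm T x c c) = c.
  by rewrite gpermK permK.
move=> [[x c] d] [[y c'] d'] [Exy Ed Ec].
have Exy' : x = y by rewrite -(adjK T x c) Exy Ec adjK.
have Ecc : c = c' by rewrite -(K x c) Exy Ec K.
by subst y c'; rewrite (perm_inj Ed).
Qed.

Lemma edge_glue_sym p q : edge_glue p q -> edge_glue q p.
Proof.
case=> x a e ae; set g := gperm T x a.
have := @EdgeGlue (adj T x a) (g a) (g @: e).
rewrite adjK gpermK -/g => h.
have E : (g^-1)%g @: (g @: e) = e.
  rewrite -imset_comp -[RHS]imset_id; apply: eq_imset => u /=.
  exact: permK.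
by rewrite E in h; apply: h; rewrite mem_imset //; exact: perm_inj.
Qed.

(* The edge around which [turn] turns. *)
Definition turn_edge (f : X * 'I_4 * 'I_4) : X * {set 'I_4} :=
  (f.1.1, ~: [set f.1.2; f.2]).

Lemma imset_setC2 (g : 'S_4) c d : g @: (~: [set c; d]) = ~: [set g c; g d].
Proof.
apply/finset.setP=> u; rewrite -[u](permKV g) mem_imset; last exact: perm_inj.
by rewrite !inE !(inj_eq perm_inj).
Qed.

Lemma turn_edge_glue f q : edge_glue (turn_edge f) q ->
  q = turn_edge (turn f) \/ (forall f', turn f' = f -> q = turn_edge f').
Proof.
case: f => [[x c] d]; rewrite /turn_edge /=.
move E0 : (x, ~: [set c; d]) => p pq; case: pq E0 => {p q} y a e ae [-> ee].
subst e; move: ae; rewrite !inE negbK => /orP[/eqP ->|/eqP ->].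
  by left; rewrite imset_setC2 finset.setUC.
right=> -[[z c'] d'] [<- <- <-]; rewrite adjK gpermK imset_setC2 !permK.
by rewrite finset.setUC.
Qed.

Lemma walk_cat x u v : walk x (u ++ v) = walk (walk x u) v.
Proof. exact: foldl_cat. Qed.

Fixpoint walk_rev (x : X) (w : seq 'I_4) : seq 'I_4 :=
  if w is a :: w' then rcons (walk_rev (adj T x a) w') (gperm T x a a)
  else [::].

Lemma walk_revK x w : walk (walk x w) (walk_rev x w) = x.
Proof.
elim: w x => //= a w IHw x.
by rewrite -cats1 walk_cat IHw /= adjK.
Qed.

End Triangulation.

(* ------------------------------------------------------------------------ *)
(** * The link of the ideal vertices, i.e. the boundary of M *)

Section Link.
Variables (N : nat) (T : triangulation 'I_N).

(* The link is a union of triangles [(x, v)], one for each vertex [v] of each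
   tetrahedron [x].  The triangle [(x, v)] has a side [(x, v, a)] on the face
   opposite to [a] and a corner [(x, v, u)] on the edge [vu], for [a, u != v]. *)
Definition link_glue : rel ('I_N * 'I_4) := fun p q =>
  [exists a, (a != p.2) && (q == (adj T p.1 a, gperm T p.1 a p.2))].

Definition link_side_glue : rel ('I_N * 'I_4 * 'I_4) := fun p q =>
  let: (x, v, a) := p in q == (adj T x a, gperm T x a v, gperm T x a a).

Definition link_corner_glue : rel ('I_N * 'I_4 * 'I_4) := fun p q =>
  let: (x, v, u) := p in
  [exists a, [&& a != v, a != u
     & q == (adj T x a, gperm T x a v, gperm T x a u)]].

Definition link_euler : int :=
  (n_comp link_corner_glue [pred p | p.1.2 != p.2])%:Z
  - (n_comp link_side_glue [pred p | p.1.2 != p.2])%:Z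
  + #|{: 'I_N * 'I_4}|%:Z.

(* The link is a closed triangulated surface, since its sides are glued in
   pairs, and it inherits an orientation from one of the triangulation.  So it
   is a torus iff it is connected and has zero Euler characteristic. *)
Definition torus_link :=
  (forall p q, connect link_glue p q) /\ link_euler = 0.

End Link.

(* ------------------------------------------------------------------------ *)
(** * Homotopy of paths in the dual 2-complex *)

Section Homotopy.
Variables (N : nat) (T : triangulation 'I_N).

(* The word read by turning once around an edge: the attaching map of the
   2-cell dual to that edge. *)
Definition edge_loop (f : 'I_N * 'I_4 * 'I_4) : seq 'I_4 :=
  [seq (iter l (turn T) f).1.2 | l <- iota 0 (order (turn T) f)].

Inductive elementary (x : 'I_N) : seq 'I_4 -> seq 'I_4 -> Prop :=
| Backtrack u v a :
    elementary x (u ++ [:: a; gperm T (walk T x u) a a] ++ v) (u ++ v)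
| AroundEdge u v c d : c != d ->
    elementary x (u ++ edge_loop (walk T x u, c, d) ++ v) (u ++ v).

Definition homotopic (x : 'I_N) := clos_refl_sym_trans _ (elementary x).

Lemma walk_edge_loop f : walk T f.1.1 (edge_loop f) = f.1.1.
Proof.
rewrite /edge_loop.
have E n : walk T f.1.1 [seq (iter l (turn T) f).1.2 | l <- iota 0 n]
           = (iter n (turn T) f).1.1.
  elim: n => // n IHn.
  rewrite -[in iota _ _]addn1 iotaD map_cat walk_cat IHn add0n /=.
  by case: (iter n _ f) => [[]].
by rewrite E iter_order //; exact: turn_inj.
Qed.

Lemma homotopic_walk x u v : homotopic x u v -> walk T x u = walk T x v.
Proof.
elim=> {u v} [u v []|//|u v _ -> //|u v w _ -> _ -> //].
- by move=> {}u {}v a; rewrite !walk_cat /= adjK.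
- move=> {}u {}v c d _; rewrite !walk_cat.
  by rewrite (walk_edge_loop (walk T x u, c, d)).
Qed.

Lemma homotopic_catr x u v w :
  homotopic x u v -> homotopic x (u ++ w) (v ++ w).
Proof.
elim=> {u v} [u v []|u|u v _|u v z _ H1 _ H2].
- by move=> {}u {}v a; rewrite -!catA; apply: rst_step; exact: Backtrack.
- by move=> {}u {}v c d cd; rewrite -!catA; apply: rst_step; exact: AroundEdge.
- exact: rst_refl.
- exact: rst_sym.
- exact: rst_trans H1 H2.
Qed.

Lemma homotopic_catl x w u v :
  homotopic (walk T x w) u v -> homotopic x (w ++ u) (w ++ v).
Proof.
elim=> {u v} [u v []|u|u v _|u v z _ H1 _ H2].
- move=> {}u {}v a; apply: rst_step.
  by rewrite -walk_cat !(catA w); exact: Backtrack.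
- move=> {}u {}v c d cd; apply: rst_step.
  by rewrite -walk_cat !(catA w); exact: AroundEdge.
- exact: rst_refl.
- exact: rst_sym.
- exact: rst_trans H1 H2.
Qed.

Lemma homotopic_revr x w : homotopic x (w ++ walk_rev T x w) [::].
Proof.
elim: w x => [|a w IHw] x /=; first exact: rst_refl.
rewrite -rcons_cat -cats1.
apply: (rst_trans _ _ _ ([:: a] ++ [::] ++ [:: gperm T x a a])).
  by apply: (@homotopic_catl _ [:: a]); apply: homotopic_catr; exact: IHw.
by apply: rst_step; exact: (@Backtrack x [::] [::] a).
Qed.

Lemma homotopic_revl x w : homotopic (walk T x w) (walk_rev T x w ++ w) [::].
Proof.
elim: w x => [|a w IHw] x /=; first exact: rst_refl.
apply: rst_trans (IHw (adj T x a)).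
rewrite -cats1 -catA.
apply: (homotopic_catl (u := [:: gperm T x a a, a & w]) (v := w)).
rewrite walk_revK; apply: rst_step.
have := @Backtrack (adj T x a) [::] w (gperm T x a a).
by rewrite /= gpermK permK.
Qed.

Definition homotopicb (x : 'I_N) : rel (seq 'I_4) :=
  fun u v => `[< homotopic x u v >].

Lemma homotopicb_refl x : reflexive (homotopicb x).
Proof. by move=> u; apply/asboolP; exact: rst_refl. Qed.
Lemma homotopicb_sym x : symmetric (homotopicb x).
Proof. by move=> u v; apply/asboolP/asboolP; exact: rst_sym. Qed.
Lemma homotopicb_trans x : transitive (homotopicb x).
Proof. by move=> v u w /asboolP uv /asboolP vw; apply/asboolP/(rst_trans _ _ _ _ _ uv). Qed.

Canonical homotopicb_equiv x := EquivRel (homotopicb x)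
  (homotopicb_refl x) (homotopicb_sym x) (@homotopicb_trans x).

End Homotopy.

(* ------------------------------------------------------------------------ *)
(** * The universal cover and the fundamental group *)

(* The tetrahedra of the universal cover: homotopy classes of paths that start
   at the base tetrahedron [x0]. *)
Definition cover (N : nat) (T : triangulation 'I_N) (x0 : 'I_N) : Type :=
  {eq_quot homotopicb T x0}%qT.

Section Cover.
Variables (N : nat) (T : triangulation 'I_N) (x0 : 'I_N).
Local Notation Tc := (cover T x0).

Definition path_class (w : seq 'I_4) : Tc := (\pi_Tc w)%qT.
Definition path_repr (p : Tc) : seq 'I_4 := repr p.

Definition cproj (p : Tc) : 'I_N := walk T x0 (path_repr p).

Lemma path_classP u v :
  path_class u = path_class v <-> homotopic T x0 u v.
Proof. by split=> [/eqP|/asboolP h]; [|apply/eqP]; rewrite piE //= => /asboolP. Qed.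

Lemma path_reprK p : path_class (path_repr p) = p.
Proof. exact: reprK. Qed.

Lemma path_repr_class w : homotopic T x0 (path_repr (path_class w)) w.
Proof. by apply/path_classP; rewrite path_reprK. Qed.

Lemma cproj_class w : cproj (path_class w) = walk T x0 w.
Proof. exact/homotopic_walk/path_repr_class. Qed.

Definition cadj (p : Tc) (a : 'I_4) : Tc := path_class (rcons (path_repr p) a).
Definition cgperm (p : Tc) (a : 'I_4) : 'S_4 := gperm T (cproj p) a.

Lemma cproj_cadj p a : cproj (cadj p a) = adj T (cproj p) a.
Proof. by rewrite cproj_class -cats1 walk_cat. Qed.

Lemma cadjK p a : cadj (cadj p a) (cgperm p a a) = p.
Proof.
rewrite -[RHS]path_reprK; apply/path_classP.
rewrite -cats1.
apply: (rst_trans _ _ _ (rcons (path_repr p) a ++ [:: cgperm p a a])).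
  by apply: homotopic_catr; exact: path_repr_class.
have := @Backtrack _ T x0 (path_repr p) [::] a.
by rewrite !cats0 -cats1 -catA => h; apply: rst_step.
Qed.

Lemma cgpermK p a : cgperm (cadj p a) (cgperm p a a) = (cgperm p a)^-1%g.
Proof. by rewrite /cgperm cproj_cadj gpermK. Qed.

Lemma cface_free p a : ~ (cadj p a = p /\ cgperm p a a = a).
Proof.
by case=> /(congr1 cproj); rewrite cproj_cadj => h1 h2; apply: (face_free (conj h1 h2)).
Qed.

Definition cover_triangulation : triangulation Tc :=
  Triangulation cadjK cgpermK cface_free.

(* The fundamental group: homotopy classes of closed paths at [x0], with
   concatenation as product. *)
Definition pi1 : Type := {p : Tc | cproj p == x0}.

HB.instance Definition _ := Choice.on pi1.

(* Deck transformations: precomposition with a closed path. *)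
Definition deck (g : pi1) (p : Tc) : Tc :=
  path_class (path_repr (val g) ++ path_repr p).

Lemma pi1_walk (g : pi1) : walk T x0 (path_repr (val g)) = x0.
Proof. exact/eqP/(valP g). Qed.

Lemma cproj_deck g p : cproj (deck g p) = cproj p.
Proof. by rewrite cproj_class walk_cat pi1_walk. Qed.

Lemma deck_class (g : pi1) u w :
  val g = path_class u -> deck g (path_class w) = path_class (u ++ w).
Proof.
move=> gu; apply/path_classP.
apply: (rst_trans _ _ _ (path_repr (val g) ++ w)).
  by apply: homotopic_catl; rewrite pi1_walk; exact: path_repr_class.
by apply: homotopic_catr; rewrite gu; exact: path_repr_class.
Qed.

Fact pi1_one_subproof : cproj (path_class [::]) == x0.
Proof. by rewrite cproj_class. Qed.
Definition pi1_one : pi1 := exist (fun p => cproj p == x0) _ pi1_one_subproof.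

Fact pi1_mul_subproof (g h : pi1) : cproj (deck g (val h)) == x0.
Proof. by rewrite cproj_deck (valP h). Qed.
Definition pi1_mul (g h : pi1) : pi1 := exist (fun p => cproj p == x0) _ (pi1_mul_subproof g h).

Fact pi1_inv_subproof (g : pi1) :
  cproj (path_class (walk_rev T x0 (path_repr (val g)))) == x0.
Proof. by rewrite cproj_class -{1}(pi1_walk g) walk_revK. Qed.
Definition pi1_inv (g : pi1) : pi1 := exist (fun p => cproj p == x0) _ (pi1_inv_subproof g).

Lemma deck_mul g h p : deck (pi1_mul g h) p = deck g (deck h p).
Proof.
rewrite -{1}[p]path_reprK -[deck h p]/(path_class _).
rewrite (@deck_class _ (path_repr (val g) ++ path_repr (val h))) //.
by rewrite (@deck_class _ (path_repr (val g))) ?path_reprK // catA.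
Qed.

Lemma deck_one p : deck pi1_one p = p.
Proof. by rewrite -{1}[p]path_reprK (@deck_class _ [::]) // path_reprK. Qed.

Fact pi1_mulA : associative pi1_mul.
Proof. by move=> g h k; apply: val_inj; rewrite /= deck_mul. Qed.

Fact pi1_mul1g : left_id pi1_one pi1_mul.
Proof. by move=> g; apply: val_inj; rewrite /= deck_one. Qed.

Fact pi1_mulg1 : right_id pi1_one pi1_mul.
Proof.
move=> g; apply: val_inj => /=.
by rewrite (@deck_class _ (path_repr (val g))) ?path_reprK // cats0 path_reprK.
Qed.

Fact pi1_mulVg : left_inverse pi1_one pi1_inv pi1_mul.
Proof.
move=> g; apply: val_inj => /=.
rewrite -[sval g]path_reprK (deck_class (u := walk_rev T x0 (path_repr (val g)))) //.
by apply/path_classP; rewrite -{1}(pi1_walk g); exact: homotopic_revl.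
Qed.

Fact pi1_mulgV : right_inverse pi1_one pi1_inv pi1_mul.
Proof.
move=> g; apply: val_inj => /=.
rewrite (deck_class (u := path_repr (val g))) ?path_reprK //.
by apply/path_classP; exact: homotopic_revr.
Qed.

HB.instance Definition _ := isGroup.Build pi1
  pi1_mulA pi1_mul1g pi1_mulg1 pi1_mulVg pi1_mulgV.

Lemma deck_inj p : injective (deck^~ p).
Proof.
move=> g h; rewrite /deck => /path_classP gh; apply: val_inj.
rewrite -[LHS]path_reprK -[RHS]path_reprK; apply/path_classP.
have H (k : pi1) : homotopic T x0 (path_repr (val k))
    ((path_repr (val k) ++ path_repr p) ++ walk_rev T x0 (path_repr p)).
  rewrite -catA -[X in homotopic _ _ X]cats0; apply: rst_sym.
  by apply: homotopic_catl; rewrite pi1_walk; exact: homotopic_revr.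
apply: rst_trans (H g) _; apply: rst_trans (rst_sym _ _ _ _ (H h)).
exact: homotopic_catr.
Qed.

Lemma deck_finite (s : seq Tc) p : finite_set (fun g => deck g p \in s).
Proof.
have := @finite_preimage _ _ [set` s]%classic (deck^~ p).
apply; last exact: finite_seq.
by move=> g h _ _; exact: deck_inj.
Qed.

Let cturn := turn cover_triangulation.
Let flag_proj (f : Tc * 'I_4 * 'I_4) := (cproj f.1.1, f.1.2, f.2).

Lemma iter_turn_proj l f : flag_proj (iter l cturn f) = iter l (turn T) (flag_proj f).
Proof.
elim: l => //= l <-; case: (iter l cturn f) => [[p c] d].
by rewrite /cturn /flag_proj /= cproj_cadj.
Qed.

Lemma iter_turn_order p c d : c != d ->
  iter (order (turn T) (cproj p, c, d)) cturn (p, c, d) = (p, c, d).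
Proof.
move=> cd; set n := order _ _.
have E l : (iter l cturn (p, c, d)).1.1 = path_class (path_repr p ++
    [seq (iter k (turn T) (cproj p, c, d)).1.2 | k <- iota 0 l]).
  elim: l => [|l IHl]; first by rewrite cats0 path_reprK.
  rewrite -[in iota _ _]addn1 iotaD map_cat catA /=.
  have := iter_turn_proj l (p, c, d).
  rewrite {2}/flag_proj /= => <-.
  case: (iter l _ _) IHl => [[q c'] d'] /= ->.
  rewrite /cadj; apply/path_classP; rewrite -cats1; apply: homotopic_catr.
  exact: path_repr_class.
have := iter_turn_proj n (p, c, d).
rewrite {2}/flag_proj /= iter_order; last exact: turn_inj.
have := E n; case: (iter n _ _) => [[q c'] d'] /= -> [_ -> ->].
congr (_, _, _); rewrite -[RHS]path_reprK; apply/path_classP.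
rewrite -[X in homotopic _ _ _ X]cats0; apply: rst_step.
have := @AroundEdge _ T x0 (path_repr p) [::] _ _ cd.
by rewrite !cats0.
Qed.

Lemma same_edge_turn p c d q : c != d ->
  same_edge cover_triangulation (turn_edge (p, c, d)) q ->
  exists2 l, (l < order (turn T) (cproj p, c, d))%N
    & q = turn_edge (iter l cturn (p, c, d)).
Proof.
move=> cd; set n := order _ _; set f := (p, c, d) => pq.
have n0 : (0 < n)%N by exact: order_gt0.
have per : iter n cturn f = f by exact: iter_turn_order.
pose inv q := exists l, q = turn_edge (iter l cturn f).
have step u v : edge_glue cover_triangulation u v -> inv u -> inv v.
  move=> uv [l lE]; rewrite lE in uv.
  case: (turn_edge_glue uv) => [->|h]; first by exists l.+1.
  exists (l + n).-1; apply: h.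
  have -> m : turn cover_triangulation (iter m cturn f) = iter m.+1 cturn f by [].
  rewrite prednK.
    by rewrite iterD per.
  by rewrite addn_gt0 n0 orbT.
have inv_iff u v : same_edge cover_triangulation u v -> (inv u <-> inv v).
  elim=> {u v} [u v uv|//|u v _ [? ?]//|u v w _ [? ?] _ [? ?]].
  - by split; apply: step => //; exact: edge_glue_sym.
  - by split; auto.
have [|l ->] := (inv_iff _ _ pq).1; first by exists 0%N.
exists (l %% n)%N; first by rewrite ltn_mod.
rewrite {1}(divn_eq l n) addnC iterD; congr (turn_edge (iter _ _ _)).
by elim: (l %/ n)%N => //= k IHk; rewrite mulSn iterD IHk.
Qed.

(* Each edge of the universal cover meets finitely many tetrahedra. *)
Lemma same_edge_finite p e (q : Tc * {set 'I_4}) : #|q.2| = 2%N ->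
  finite_set (fun g => same_edge cover_triangulation (deck g p, e) q).
Proof.
case: q => q e' /= e'2.
have [c [d [cd e'E]]] : exists c d, c != d /\ ~: e' = [set c; d].
  have : #|~: e'| == 2%N.
    by rewrite -(eqn_add2l #|e'|) cardsC card_ord e'2.
  by case/cards2P=> c [d [cd ->]]; exists c, d.
pose s := [seq (iter l cturn (q, c, d)).1.1
  | l <- iota 0 (order (turn T) (cproj q, c, d))].
apply: sub_finite_set (deck_finite s p) => g /= /(@rst_sym _ _ _ _) h.
have := @same_edge_turn q c d (deck g p, e) cd.
rewrite /turn_edge /= -e'E finset.setCK => /(_ h)[l ln [-> _]].
by apply/mapP; exists l => //; rewrite mem_iota.
Qed.

End Cover.

(* ------------------------------------------------------------------------ *)
(** * The field Q(t) and the map Z[pi] -> Z[t^{+-1}] *)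

Definition Qt := {fraction {poly rat}}.
Definition tvar : Qt := tofrac 'X.

(* Z[t^{+-1}], as a subring of Q(t). *)
Definition laurent (x : Qt) : Prop :=
  exists (p : {poly int}) (k : nat),
    x = tofrac (map_poly (intr : int -> rat) p) / tvar ^+ k.

(* Equality up to multiplication by [+- t ^ k]. *)
Definition doteq (x y : Qt) : Prop :=
  exists (s : bool) (k : int), x = (-1) ^+ s * tvar ^ k * y.

Section GroupRing.
Variables (N : nat) (T : triangulation 'I_N) (x0 : 'I_N).
Local Notation Tc := (cover T x0).
Local Notation pi := (pi1 T x0).

(* Elements of Z[pi] are given by their coefficients.  All those considered
   below have finite support: see [twisted_nz_finite], [bound2_finite] and
   [bound1_finite]. *)
Definition group_ring := pi -> int.

Definition twist (alpha : pi -> int) (r : group_ring) : Qt :=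
  \sum_(g \in (setT : set pi)) (r g)%:~R * tvar ^ alpha g.

(* ------------------------------------------------------------------------ *)
(** * The twisted Neumann-Zagier matrix *)

(* Each class of edges of the triangulation is represented exactly once by a
   member of the family [E] (each member being an edge, i.e. a pair). *)
Definition edge_transversal n (E : 'I_n -> 'I_N * {set 'I_4}) :=
  (forall i, #|(E i).2| = 2%N) /\
  (forall (x : 'I_N) (e : {set 'I_4}), #|e| = 2%N ->
     exists! i, same_edge T (E i) (x, e)).

Record lifts := Lifts {
  edge_lift : 'I_N -> Tc * {set 'I_4};
  tet_lift : 'I_N -> Tc;
  edge_liftP :
    edge_transversal (fun i => (cproj (edge_lift i).1, (edge_lift i).2));
  tet_liftP : forall j, cproj (tet_lift j) = j
}.

Inductive shape_param := Shape_z | Shape_z' | Shape_z''.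

Definition shape_mate (o : bool) (s : shape_param) : 'I_4 :=
  match s with
  | Shape_z => @Ordinal 4 1 isT
  | Shape_z' => if o then @Ordinal 4 2 isT else @Ordinal 4 3 isT
  | Shape_z'' => if o then @Ordinal 4 3 isT else @Ordinal 4 2 isT
  end.

(* The edge [e] of a tetrahedron of sign [o] has the parameter [s]: it is the
   edge from 0 to [shape_mate o s] or the opposite one.  The cyclic order of the
   parameters around a vertex depends only on the orientation of M; the two
   possible conventions are exchanged by reversing the orientation. *)
Definition has_shape (o : bool) (s : shape_param) (e : {set 'I_4}) : bool :=
  let e0 := [set ord0; shape_mate o s] in (e == e0) || (e == ~: e0).

Definition nz_count (o : 'I_N -> bool) (L : lifts) (s : shape_param) (g : pi) :
    'M[int]_N :=
  \matrix_(i, j) #|[set e : {set 'I_4} | has_shape (o j) s e &&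
    `[< same_edge (cover_triangulation T x0)
          (deck g (tet_lift L j), e) (edge_lift L i) >]]|%:Z.

(* The matrix B = G'' - G'. *)
Definition twisted_nz (o : 'I_N -> bool) (L : lifts) : 'M[group_ring]_N :=
  \matrix_(i, j) fun g =>
    nz_count o L Shape_z'' g i j - nz_count o L Shape_z' g i j.

Lemma twisted_nz_finite o L i j :
  finite_set (fun g => twisted_nz o L i j g != 0).
Proof.
pose S e : set pi := fun g => same_edge (cover_triangulation T x0)
  (deck g (tet_lift L j), e) (edge_lift L i).
have fS : finite_set (\bigcup_(e in setT) S e)%classic.
  apply: bigcup_finite; first exact: finite_finset.
  by move=> e _; apply: same_edge_finite; have [/(_ i)] := edge_liftP L.
apply: sub_finite_set fS => g; apply: contraPP => nS.
have E s : nz_count o L s g i j = 0.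
  rewrite mxE; apply/eqP; rewrite eqz_nat cards_eq0; apply/eqP/setP => e.
  rewrite !inE; apply/negbTE/negP => /andP[_ /asboolP h].
  by apply: nS; exists e.
by rewrite mxE !E subr0 eqxx.
Qed.

(* ------------------------------------------------------------------------ *)
(** * The chain complex of the universal cover of the dual complex *)

(* The directed edges of the dual complex are the pairs [(x, a)], going from [x]
   to [adj x a]; reversing the direction gives [flip (x, a)]. *)
Definition flip X (S : triangulation X) (f : X * 'I_4) : X * 'I_4 :=
  (adj S f.1 f.2, gperm S f.1 f.2 f.2).

(* Lifts of the cells of the dual complex, with arbitrary orientations: the
   face [k] is lifted to a directed dual edge, and the 2-cell dual to the [i]-th
   edge to a triple as in [turn], which fixes an orientation and a starting
   point on its boundary. *)
Record cell_lifts := CellLifts {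
  cell0 : 'I_N -> Tc;
  cell1 : 'I_(N + N) -> Tc * 'I_4;
  cell2 : 'I_N -> Tc * 'I_4 * 'I_4;
  cell0P : forall j, cproj (cell0 j) = j;
  cell1P : forall f : 'I_N * 'I_4, exists! k,
    let fk := (cproj (cell1 k).1, (cell1 k).2) in f = fk \/ f = flip T fk;
  cell2_neq : forall i, (cell2 i).1.2 != (cell2 i).2;
  cell2P : edge_transversal (fun i =>
    (cproj (cell2 i).1.1, ~: [set (cell2 i).1.2; (cell2 i).2]))
}.

Variable D : cell_lifts.

(* The directed dual edges along the boundary of the [i]-th 2-cell. *)
Definition boundary2 (i : 'I_N) : seq (Tc * 'I_4) :=
  let: (p, c, d) := cell2 D i in
  [seq (iter l (turn (cover_triangulation T x0)) (p, c, d)).1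
     | l <- iota 0 (order (turn T) (cproj p, c, d))].

Definition deck1 (g : pi) (f : Tc * 'I_4) : Tc * 'I_4 := (deck g f.1, f.2).

(* The coefficient of [g] in the entry [(i, k)] is that of the cell
   [g . cell1 k] in the boundary of [cell2 i]; same in degree 1. *)
Definition bound2 : 'M[group_ring]_(N, N + N) := \matrix_(i, k) fun g =>
  (count_mem (deck1 g (cell1 D k)) (boundary2 i))%:Z
  - (count_mem (flip (cover_triangulation T x0) (deck1 g (cell1 D k)))
       (boundary2 i))%:Z.

Definition bound1 : 'M[group_ring]_(N + N, N) := \matrix_(k, j) fun g =>
  let: (p, a) := cell1 D k in
  (cadj p a == deck g (cell0 D j))%:Z - (p == deck g (cell0 D j))%:Z.

Lemma flipK X (S : triangulation X) : involutive (flip S).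
Proof. by move=> [x a]; rewrite /flip /= adjK gpermK permK. Qed.

Lemma bound2_finite i k : finite_set (fun g => bound2 i k g != 0).
Proof.
pose s := boundary2 i ++ map (flip (cover_triangulation T x0)) (boundary2 i).
apply: sub_finite_set (deck_finite (map fst s) (cell1 D k).1) => g.
rewrite mxE; apply: contraTT => gs.
have ns f : f.1 = deck g (cell1 D k).1 -> f \notin s.
  by move=> fE; apply: contra gs => fs; rewrite -fE map_f.
have := ns (deck1 g (cell1 D k)) erefl.
rewrite mem_cat negb_or => /andP[/count_memPn -> n2].
rewrite (count_memPn _) ?subrr ?eqxx //.
apply: contra n2 => h; apply/mapP; exists (flip (cover_triangulation T x0) (deck1 g (cell1 D k))) => //.
by rewrite flipK.
Qed.

Lemma bound1_finite k j : finite_set (fun g => bound1 k j g != 0).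
Proof.
set p := (cell1 D k).1; set a := (cell1 D k).2.
apply: sub_finite_set (deck_finite [:: cadj p a; p] (cell0 D j)) => g.
rewrite mxE [cell1 D k]surjective_pairing -/p -/a inE mem_seq1.
apply: contraTT; rewrite negb_or ![deck _ _ == _]eq_sym.
by move=> /andP[/negbTE -> /negbTE ->]; rewrite subrr eqxx.
Qed.

(* ------------------------------------------------------------------------ *)
(** * Acyclicity and the Alexander polynomial *)

Variable alpha : pi -> int.

Definition P2 : 'M[Qt]_(N, N + N) := map_mx (twist alpha) bound2.
Definition P1 : 'M[Qt]_(N + N, N) := map_mx (twist alpha) bound1.

Definition acyclic := \rank P2 = N /\ \rank P1 = N.

(* For an acyclic complex such a [b] exists and the quotient of determinants does
   not depend on it, so that any one of them characterizes [Delta]. *)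
Definition is_alexander (Delta : Qt) := exists b : 'M[Qt]_(N, N + N),
  [/\ forall i k, laurent (b i k), \det (b *m P1) != 0
    & doteq (Delta / (tvar - 1)) (\det (col_mx P2 b) / \det (b *m P1))].

End GroupRing.

(* Main.v *)
(** Let h be the height on the universal cover defined by alpha, and give each
    face the weight t^h at both of the tetrahedra it bounds.  Keeping only the
    incidences with faces opposite to the vertices 2, 3 gives a matrix C such
    that P2 C = B up to units, while the complementary matrix C' satisfies
    C + C' = - P1.  As P2 P1 = 0, it follows that det B is the torsion times
    det (C | C').  The latter is the weighted incidence matrix of a disjoint union
    of cycles, hence equals the product over these cycles of 1 - t^k, with k the
    value of alpha on the cycle.

    The cycles are realized by disjoint simple closed curves in the boundary
    torus.  If all the exponents k are nonzero, then no component of the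
    complement of the curves is a disc, so by Euler characteristic every one
    is an annulus; its two ends have opposite exponents, and all exponents agree
    up to sign because the torus is connected.  The Euler characteristic
    argument is carried out on permutations, through Ree's inequality. *)
Require Import Defs.
From Stdlib Require Import Relation_Operators.
From mathcomp Require Import boolp classical_sets fsbigop.
From mathcomp Require Import all_boot all_order all_algebra fingroup perm.
From mathcomp Require Import zify ring.
Import GRing.Theory Num.Theory.
Local Open Scope ring_scope.

Set Implicit Arguments.
Unset Strict Implicit.
Unset Printing Implicit Defensive.

(** * Determinants of weighted permutation matrices *)

Lemma porbit_fix (T : finType) (s : {perm T}) z : s z = z -> porbit s z = [set z].
Proof.
move=> sz; apply/setP => u; rewrite inE; apply/porbitP/eqP => [[k ->]|->].
  by elim: k => [|k IH]; rewrite ?expg0 ?perm1 // expgSr permM IH.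
by exists 0%N; rewrite expg0 perm1.
Qed.

Lemma porbitS (T : finType) (s : {perm T}) z v :
  v \in porbit s z -> s v \in porbit s z.
Proof.
by case/porbitP=> m ->; apply/porbitP; exists m.+1; rewrite expgSr permM.
Qed.

Section CycleDeterminant.
Variable R : comRingType.

Lemma row_addE n (A : 'M[R]_n) (a : R) (x y i j : 'I_n) :
  ((1%:M + a *: delta_mx x y) *m A) i j = A i j + a * (i == x)%:R * A y j.
Proof.
rewrite mulmxDl mul1mx -scalemxAl !mxE -mulrA; congr (_ + a * _).
rewrite (bigD1 y) //= big1 ?addr0 => [|k ky]; first by rewrite mxE eqxx andbT.
by rewrite mxE (negbTE ky) andbF mul0r.
Qed.

Lemma col_addE n (A : 'M[R]_n) (a : R) (x y i j : 'I_n) :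
  (A *m (1%:M + a *: delta_mx x y)) i j = A i j + a * (j == y)%:R * A i x.
Proof.
rewrite mulmxDr mulmx1 -scalemxAr !mxE -mulrA; congr (_ + a * _).
rewrite mulrC (bigD1 x) //= big1 ?addr0 => [|k kx]; first by rewrite mxE eqxx.
by rewrite mxE (negbTE kx) mulr0.
Qed.

Lemma det_elementary n (x y : 'I_n) (a : R) :
  x != y -> \det (1%:M + a *: delta_mx x y) = 1.
Proof.
move=> xy.
wlog lt_yx : x y xy / (y < x)%N.
  move=> W; case: (ltngtP y x) xy => [lt|lt|/val_inj->]; last by rewrite eqxx.
    by move=> xy; apply: W.
  move=> xy; rewrite -det_tr linearD linearZ /= trmx_delta tr_scalar_mx.
  by apply: W; rewrite // eq_sym.
rewrite det_trig.
  rewrite big1 // => i _; rewrite !mxE eqxx.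
  by case: eqP => [->|_]; rewrite ?(negbTE xy) mulr0 addr0.
apply/is_trig_mxP => i j ij; rewrite !mxE [i == j]ltn_eqF //.
case: eqP => [ix|]; last by rewrite mulr0 addr0.
case: eqP => [jy|]; rewrite ?mulr0 ?addr0 //.
by move: ij; rewrite ix jy ltnNge ltnW.
Qed.

Definition cycle_mx n (s : 'S_n) (w : 'I_n -> R) : 'M[R]_n :=
  \matrix_(i, j) ((j == i)%:R - (j == s i)%:R * w i).

(** As [tperm x y] acts first, the new permutation sends [x] straight to [s y] and fixes [y]; the
    other points keep their cyclic order. *)
Lemma porbit_drop (T : finType) (s : {perm T}) x y z : x != y -> s x = y ->
  z != y -> porbit (tperm x y * s)%g z = porbit s z :\ y.
Proof.
move=> xy sxy zy; set s' := (_ * s)%g.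
have s'E u : s' u = if u == x then s y else if u == y then y else s u.
  by rewrite /s' permM; case: tpermP => [->|->|/eqP/negbTE-> /eqP/negbTE->];
    rewrite ?eqxx // eq_sym (negbTE xy).
have s'y : s' y = y by rewrite s'E eqxx eq_sym (negbTE xy).
apply/setP => u; rewrite !inE; apply/idP/andP => [/porbitP[k ->]|[uy]].
  elim: k => [|k [IH1 IH2]]; first by rewrite expg0 perm1 zy porbit_id.
  rewrite expgSr permM; split.
    by apply: contra IH1 => /eqP; rewrite -{1}s'y => /perm_inj ->.
  rewrite s'E; have st v : v \in porbit s z -> s v \in porbit s z by exact: porbitS.
  case: eqP => [Ex|_]; first by rewrite -sxy -Ex; apply/st/st.
  by rewrite (negbTE IH1) st.
case/porbitP=> k uE.
have st v : v \in porbit s' z -> s' v \in porbit s' z by exact: porbitS.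
(* The new cycle skips [y], so when the old orbit stands at [y] the induction records the next point
   [s y] instead. *)
have : if (s ^+ k)%g z == y then s y \in porbit s' z
       else (s ^+ k)%g z \in porbit s' z.
  elim: k {uE} => [|k]; first by rewrite expg0 perm1 (negbTE zy) porbit_id.
  rewrite expgSr permM; set v := (s ^+ k)%g z.
  have syy : s y != y by apply: contra xy => /eqP; rewrite -{2}sxy => /perm_inj ->.
  case: (eqVneq v y) => [-> h|vy vin]; first by rewrite (negbTE syy).
  case: (eqVneq v x) => [vx|vx].
    by rewrite vx sxy eqxx; have := st _ vin; rewrite s'E vx eqxx.
  have -> : (s v == y) = false by rewrite -sxy (inj_eq perm_inj); apply/negbTE.
  by have := st _ vin; rewrite s'E (negbTE vx) (negbTE vy).
by rewrite -uE (negbTE uy).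
Qed.

(** This allows products over cycles to be reindexed. No cycle of [s] is lost when [y] is deleted,
    because the cycle of [y] also contains [x]. *)
Lemma porbits_drop (T : finType) (s : {perm T}) x y : x != y -> s x = y ->
  let s' := (tperm x y * s)%g in
  [/\ porbits s' = [set y] |: [set O :\ y | O in porbits s],
      [set y] \notin [set O :\ y | O in porbits s] &
      {in porbits s &, injective (fun O => O :\ y)}].
Proof.
move=> xy sxy s'.
have P z : exists2 z', z' != y & porbit s z = porbit s z'.
  case: (eqVneq z y) => [->|]; last by exists z.
  exists x => //; apply/eqP; rewrite eq_porbit_mem -sxy.
  by rewrite porbitS ?porbit_id.
split.
- apply/setP => O; rewrite !inE; apply/imsetP/orP.
    case=> z _ ->; case: (eqVneq z y) => [->|zy]; last first.
      right; apply/imsetP; exists (porbit s z); first exact: imset_f.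
      exact: porbit_drop.
    left; apply/eqP/porbit_fix.
    by rewrite /s' permM tpermR sxy.
  case=> [/eqP->|/imsetP[_ /imsetP[z _ ->] ->]].
    exists y => //; apply/esym/porbit_fix.
    by rewrite /s' permM tpermR sxy.
  have [z' zy ->] := P z; exists z' => //; exact/esym/porbit_drop.
- apply/imsetP => -[O _ /setP/(_ y)].
  by rewrite !inE eqxx.
move=> _ _ /imsetP[z1 _ ->] /imsetP[z2 _ ->].
have [u1 h1 ->] := P z1; have [u2 h2 ->] := P z2 => /setP/(_ u1).
rewrite !inE h1 porbit_id /= => /esym h.
by apply/eqP; rewrite eq_porbit_mem.
Qed.

(* If [s x = y != x], adding [w x] times row [y] to row [x] lets [x] jump over
   [y]; then [y] can be turned into a fixed point of weight 0. *)
Lemma det_cycle_mx n (s : 'S_n) (w : 'I_n -> R) :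
  \det (cycle_mx s w) = \prod_(O in porbits s) (1 - \prod_(i in O) w i).
Proof.
move: {2}(#|[set i | s i != i]|) (leqnn #|[set i | s i != i]|) => m.
elim: m s w => [|m IH] s w.
  rewrite leqn0 cards_eq0 => /eqP s1.
  have {s1}E i : s i = i.
    by apply/eqP; have /setP/(_ i) := s1; rewrite !inE => /negbFE.
  have -> : porbits s = [set [set i] | i : 'I_n].
    by apply: eq_imset => i; apply/porbit_fix/E.
  rewrite big_imset /=; last by move=> i j _ _ /set1_inj.
  rewrite det_trig; last first.
    apply/is_trig_mxP => i j ij; rewrite mxE E.
    by rewrite [j == i]gtn_eqF // mul0r subrr.
  rewrite [RHS](eq_bigl xpredT) => [|i]; last by rewrite inE.
  by apply: eq_bigr => i _; rewrite mxE E eqxx mul1r big_set1.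
move=> hm; case: (set_0Vmem [set i | s i != i]) => [s0|[x]].
  by apply: IH; rewrite s0 cards0.
rewrite inE eq_sym; move sxy: (s x) => y xy.
pose s' := (tperm x y * s)%g.
pose w' i := if i == y then 0 else if i == x then w x * w y else w i.
have s'E u : s' u = if u == x then s y else if u == y then y else s u.
  by rewrite /s' permM; case: tpermP => [->|->|/eqP/negbTE-> /eqP/negbTE->];
    rewrite ?eqxx // eq_sym (negbTE xy).
have syy : s y != y by apply: contra xy => /eqP; rewrite -{2}sxy => /perm_inj ->.
have yx : (y == x) = false by rewrite eq_sym; apply/negbTE.
have -> : \det (cycle_mx s w) = \det (cycle_mx s' w').
  (* The column operation adds [w y] times column [y] to column [s y], which clears the only
     off-diagonal entry of row [y]. *)
  have <- : (1%:M + w x *: delta_mx x y) *m cycle_mx s w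
            *m (1%:M + w y *: delta_mx y (s y)) = cycle_mx s' w'.
    apply/matrixP => i j.
    rewrite col_addE !row_addE !mxE.
    rewrite s'E /w' eqxx (eq_sym y (s y)) (negbTE syy).
    case: (eqVneq i y) => [->|iy].
      by rewrite yx (eq_sym y (s y)) (negbTE syy) /= mulr1n mulr0n; ring.
    case: (eqVneq i x) => [->|ix]; first by rewrite sxy eqxx /= ?mulr1n ?mulr0n; ring.
    have -> : (y == s i) = false.
      by rewrite -sxy (inj_eq perm_inj) eq_sym; apply/negbTE.
    by rewrite /= ?mulr1n ?mulr0n; ring.
  by rewrite !det_mulmx !det_elementary ?mul1r ?mulr1 // eq_sym.
rewrite IH; last first.
  rewrite -ltnS; apply: leq_trans hm; apply/proper_card/properP; split.
    apply/subsetP => u; rewrite !inE s'E; case: (eqVneq u x) => [-> _|ux].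
      by rewrite sxy eq_sym.
    by case: (eqVneq u y) => [->|]; rewrite ?eqxx.
  by exists y; rewrite inE // s'E yx !eqxx.
have [-> ny inj] := porbits_drop xy sxy.
rewrite big_setU1 //= big_set1 big_imset //= {1}/w' eqxx subr0 mul1r.
apply: eq_bigr => O /imsetP[z _ ->]; congr (1 - _).
case: (boolP (y \in porbit s z)) => yz; last first.
  have -> : porbit s z :\ y = porbit s z by apply/setDidPl; rewrite disjoint_sym disjoints1.
  apply: eq_bigr => i iz; rewrite /w' (negbTE (memPn yz i iz)).
  case: eqP => // ix; case/negP: yz; rewrite -sxy -ix.
  exact: porbitS.
have xz : x \in porbit s z.
  move: yz; rewrite -!eq_porbit_mem => /eqP <-; rewrite eq_porbit_mem.
  by rewrite -sxy porbit_sym porbitS ?porbit_id.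
rewrite [in RHS](big_setD1 y) //= [in RHS](big_setD1 x) //=; last by rewrite !inE xy.
rewrite [LHS](big_setD1 x) //=; last by rewrite !inE xy.
rewrite mulrA; congr (_ * _).
  by rewrite /w' (negbTE xy) eqxx mulrC.
by apply: eq_bigr => i; rewrite /w' !inE => /and3P[/negbTE-> /negbTE->].
Qed.

End CycleDeterminant.

(** * Ree's inequality *)

Lemma porbit_eqP (T : finType) (s : {perm T}) (K : Type) (f : T -> K) :
  (forall z, f (s z) = f z) -> forall x y, y \in porbit s x -> f y = f x.
Proof.
move=> fs x y /porbitP[k ->]; elim: k => [|k IH]; first by rewrite expg0 perm1.
by rewrite expgSr permM fs.
Qed.

(* Ree's inequality: multiplying [b] by a transposition splits off a cycle of
   [b]; it changes the number of cycles of the product by one, and it decreases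
   that number only if the two points were already in the same class. *)
Lemma ree (T : finType) (a b : {perm T}) :
  exists f : T -> T, [/\ forall z, f (a z) = f z, forall z, f (b z) = f z &
    (#|porbits a| + #|porbits b| + #|porbits (b * a)|
       <= #|T| + (#|f @: T|).*2)%N].
Proof.
move: {2}(#|[set i | b i != i]|) (leqnn #|[set i | b i != i]|) => m.
elim: m b => [|m IH] b.
  rewrite leqn0 cards_eq0 => /eqP b1.
  have {}b1 : b = 1%g.
    apply/permP => i; rewrite perm1; apply/eqP.
    by have /setP/(_ i) := b1; rewrite !inE => /negbFE.
  pose f z := odflt z [pick u in porbit a z].
  have fP z : f z \in porbit a z.
    by rewrite /f; case: pickP => [u|/(_ z)] //=; rewrite porbit_id.
  have fE z u : porbit a z = porbit a u -> f z = f u.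
    rewrite /f => ->; case: pickP => [//|/(_ u)].
    by rewrite porbit_id.
  have zE z : porbit a (a z) = porbit a z.
    by apply/eqP; rewrite eq_porbit_mem porbitS ?porbit_id.
  exists f; split=> [z|z|]; first exact/fE/zE.
    by rewrite b1 perm1.
  rewrite b1 mul1g.
  have -> : #|porbits (1 : {perm T})| = #|T|.
    have -> : porbits 1 = [set [set i] | i : T].
      by apply: eq_imset => i; rewrite porbit_fix ?perm1.
    by rewrite card_imset //; exact: set1_inj.
  rewrite -addnn addnAC [X in (_ <= X)%N]addnC leq_add2r !addnn leq_double.
  have -> : porbits a = (porbit a) @: (f @: T).
    rewrite -imset_comp; apply: eq_imset => z /=.
    by apply/eqP; rewrite eq_porbit_mem porbit_sym.
  exact: leq_imset_card.
move=> hm; case: (set_0Vmem [set i | b i != i]) => [s0|[x]].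
  by apply: IH; rewrite s0 cards0.
rewrite inE eq_sym; move bxy: (b x) => y xy.
pose b' := (tperm x y * b)%g.
have b'E u : b' u = if u == x then b y else if u == y then y else b u.
  by rewrite /b' permM; case: tpermP => [->|->|/eqP/negbTE-> /eqP/negbTE->];
    rewrite ?eqxx // eq_sym (negbTE xy).
have bE : b = (tperm x y * b')%g by rewrite mulgA tperm2 mul1g.
have byy : b y != y by apply: contra xy => /eqP; rewrite -{2}bxy => /perm_inj ->.
have yx : (y == x) = false by rewrite eq_sym; apply/negbTE.
have b'm : (#|[set i | b' i != i]| <= m)%N.
  rewrite -ltnS; apply: leq_trans hm; apply/proper_card/properP; split.
    apply/subsetP => u; rewrite !inE b'E; case: (eqVneq u x) => [-> _|ux].
      by rewrite bxy eq_sym.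
    by case: (eqVneq u y) => [->|]; rewrite ?eqxx.
  by exists y; rewrite inE // b'E yx !eqxx.
have [f [fa fb' le]] := IH b' b'm.
have bx : x \in porbit b y by rewrite porbit_sym -bxy porbitS ?porbit_id.
have xb' : x \notin porbit b' y.
  by rewrite porbit_fix ?inE // b'E yx eqxx.
have /= E1 := porbits_mul_tperm b' x y.
rewrite -bE xb' (negbTE xy) /= in E1.
have /= E2 := porbits_mul_tperm (b' * a)%g x y.
rewrite mulgA -bE xy /= in E2.
have fba z : f ((b' * a)%g z) = f z by rewrite permM fa fb'.
have bz z : b z = b' (tperm x y z) by rewrite {1}bE permM.
have [fxy|fxy] := eqVneq (f x) (f y).
  exists f; split=> // [z|]; last first.
    have ar p q q' r r' n k (e : bool) : (q + 2 = q' + 1 -> r + e.*2 = r' + 1 ->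
      p + q' + r' <= n + k -> p + q + r <= n + k)%N by case: e => /=; lia.
    exact: ar E1 E2 le.
  by rewrite bz fb'; case: tpermP => [->|->|].
(* Merging the values at [x] and [y] costs at most one value. As they differed, [x] and [y] lie in
   distinct cycles of [b' * a], so [b * a] has one cycle less than [b' * a], just as [b] has one
   less than [b']. *)
pose g z := if f z == f x then f y else f z.
have gx : g x = g y by rewrite /g eqxx eq_sym (negbTE fxy).
exists g; split=> [z|z|]; first by rewrite /g fa.
  have -> : g (b z) = g (tperm x y z) by rewrite /g bz fb'.
  by case: tpermP => [->|->|].
have xba : x \notin porbit (b' * a)%g y.
  by apply: contra fxy => h; rewrite (porbit_eqP fba h).
have leg : (#|f @: T| <= #|g @: T|.+1)%N.
  rewrite (cardsD1 (f x)) imset_f // add1n ltnS; apply/subset_leq_card/subsetP.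
  move=> u /setD1P[h /imsetP[z _ zE]]; apply/imsetP; exists z => //.
  by rewrite /g -zE (negbTE h).
rewrite xba /= in E2.
have ar p q q' r r' n k k' : (q + 2 = q' + 1 -> r + 2 = r' + 1 ->
  p + q' + r' <= n + k.*2 -> k <= k'.+1 -> p + q + r <= n + k'.*2)%N by lia.
exact: ar E1 E2 le leg.
Qed.

(** A vanishing sum of nonzero terms is not a single term, so every fibre over [Q] has at least two
    elements; the bound on [A] then leaves exactly two, with opposite values. It serves for [A] the
    sides of the curves and [Q] the pieces of the cut link. *)
Lemma fibre_absz (S K : finType) (A : {set S}) (Q : {set K}) (q : S -> K)
    (n : S -> int) :
  (#|A| <= (#|Q|).*2)%N -> (forall k, k \in Q -> exists2 s, s \in A & q s = k) ->
  (forall s, s \in A -> q s \in Q) -> (forall s, s \in A -> n s != 0) ->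
  (forall k, \sum_(s in A | q s == k) n s = 0) ->
  forall s t, s \in A -> t \in A -> q s = q t -> `|n s|%N = `|n t|%N.
Proof.
move=> leA surj AQ n0 sum0 s t sA tA qst.
have [->//|st] := eqVneq s t.
pose fib k := [set u in A | q u == k].
have two u : u \in A -> exists2 v, v \in A & (q v == q u) && (v != u).
  move=> uA; apply/exists_inP; apply: contraT; rewrite negb_exists_in => /forall_inP h.
  have := sum0 (q u); rewrite (bigD1 u) /=; last by rewrite uA eqxx.
  rewrite big1 => [|v /andP[/andP[vA e] ne]].
    by rewrite addr0 => /eqP; rewrite (negbTE (n0 _ uA)).
  by have := h v vA; rewrite e ne.
have ge2 k : k \in Q -> (2 <= #|fib k|)%N.
  case/surj => u uA uk; have [v vA /andP[/eqP e ne]] := two u uA.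
  rewrite (cardsD1 u) (cardsD1 v (fib k :\ u)) !inE uA vA ne e uk eqxx.
  by rewrite addnA leq_addr.
have sumA : #|A| = (\sum_(k in Q) #|fib k|)%N.
  rewrite -sum1_card (partition_big q (mem Q)) //=.
  by apply: eq_bigr => k _; rewrite -sum1_card; apply: eq_bigl => u; rewrite inE.
have eq2 : (#|fib (q s)| <= 2)%N.
  move: leA; rewrite sumA (bigD1 (q s)) ?AQ //= -muln2 -sum_nat_const.
  rewrite [X in (_ <= X)%N](bigD1 (q s)) ?AQ //=.
  have : (\sum_(k in Q | k != q s) 2 <= \sum_(k in Q | k != q s) #|fib k|)%N.
    by apply: leq_sum => k /andP[kQ _]; exact: ge2.
  lia.
have fibE : fib (q s) = [set s; t].
  apply/eqP; rewrite eq_sym eqEcard cards2 st eq2 andbT.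
  by apply/subsetP => u; rewrite !inE => /orP[]/eqP->; rewrite ?sA ?tA -?qst eqxx.
have := sum0 (q s).
have -> : \sum_(u in A | q u == q s) n u = \sum_(u in fib (q s)) n u.
  by apply: eq_bigl => u; rewrite inE.
rewrite fibE big_setU1 ?inE //= big_set1 => /eqP; rewrite addr_eq0 => /eqP ->.
by rewrite abszN.
Qed.

(** * Darts of the link and their permutations *)

Section Darts.
Variables (N : nat) (T : triangulation 'I_N) (o : 'I_N -> bool).
Hypotheses (Tor : oriented T o) (Tord : ordered T).

Local Notation flag := ('I_N * 'I_4)%type.
Local Notation dart := ('I_N * 'I_4 * 'I_3)%type.

Lemma ord3_ind (P : 'I_3 -> Prop) :
  P (@Ordinal 3 0 isT) -> P (@Ordinal 3 1 isT) -> P (@Ordinal 3 2 isT) ->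
  forall k, P k.
Proof.
by move=> P0 P1 P2 [[|[|[|k]]] lt] //; rewrite (bool_irrelevance lt isT).
Qed.

Lemma ord4_ind (P : 'I_4 -> Prop) :
  P (@Ordinal 4 0 isT) -> P (@Ordinal 4 1 isT) -> P (@Ordinal 4 2 isT) ->
  P (@Ordinal 4 3 isT) -> forall a, P a.
Proof.
by move=> P0 P1 P2 P3 [[|[|[|[|a]]]] lt] //; rewrite (bool_irrelevance lt isT).
Qed.

Lemma ltn_lift n (a : 'I_n) (k l : 'I_n.-1) : (k < l)%N -> (lift a k < lift a l)%N.
Proof. by rewrite /= ![(bump _ _ < _)%N]ltnNge leq_bump2 -ltnNge. Qed.

(** An order-preserving gluing acts on the three vertices of a face as an increasing self-map of
    three indices, hence as the identity. *)
Lemma gperm_lift x a k : gperm T x a (lift a k) = lift (gperm T x a a) k.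
Proof.
set g := gperm T x a.
have /all_sig[f fE] (l : 'I_3) : {l' | g (lift a l) = lift (g a) l'}.
  have : g a != g (lift a l) by rewrite (inj_eq perm_inj) neq_lift.
  by move/unlift_some => [l' e _]; exists l'.
have mono (i j : 'I_3) : (i < j)%N -> (f i < f j)%N.
  have ne (l : 'I_3) : lift a l != a by rewrite eq_sym neq_lift.
  move=> ij; have := Tord x (ne i) (ne j) (ltn_lift a ij); rewrite -/g !fE.
  by rewrite !ltnNge; apply: contra; rewrite /= leq_bump2.
rewrite fE; congr (lift _ _); apply: val_inj => /=.
have := mono (@Ordinal 3 0 isT) (@Ordinal 3 1 isT) isT.
have := mono (@Ordinal 3 1 isT) (@Ordinal 3 2 isT) isT.
elim/ord3_ind: k; have := ltn_ord (f (@Ordinal 3 2 isT));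
  have := ltn_ord (f (@Ordinal 3 0 isT)); have := ltn_ord (f (@Ordinal 3 1 isT)).
all: by rewrite /=; lia.
Qed.

Definition positive (f : flag) : bool := odd f.2 == o f.1.

Lemma positive_flip f : positive (flip T f) = ~~ positive f.
Proof.
case: f => x a; rewrite /positive /flip /=; set b := gperm T x a a.
have E : gperm T x a = lift_perm a b 1.
  apply/permP => u; case: (unliftP a u) => [k ->|->]; last by rewrite lift_perm_id.
  by rewrite gperm_lift lift_perm_lift perm1.
have := Tor x a; rewrite E odd_lift_perm odd_perm1 addbF.
by move: (odd a) (odd b) (o x) (o (adj T x a)) => [] [] [] [].
Qed.

Definition ord3 (n : nat) : 'I_3 :=
  match n with 0 => @Ordinal 3 0 isT | 1 => @Ordinal 3 1 isT | _ => @Ordinal 3 2 isT end%N.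

(* The dart [(x, a, k)] is the side of the link triangle at the vertex
   [lift a k] of [x] that lies on the face opposite to [a].  [rho] rotates the
   three sides of a link triangle, [iota] glues the sides in pairs. *)
Definition next_ix (e : bool) (k : 'I_3) : 'I_3 := ord3 ((if e then k + 1 else k + 2) %% 3).

Definition rho (d : dart) : dart :=
  let: (x, a, k) := d in
  let b := lift a (next_ix (positive (x, a)) k) in
  (x, b, ord3 (unbump b (lift a k))).

Definition iota (d : dart) : dart := (flip T d.1, d.2).

Definition vert (d : dart) : 'I_4 := lift d.1.2 d.2.

Lemma rho3 d : rho (rho (rho d)) = d.
Proof.
case: d => [[x a] k]; rewrite /rho /positive /=; case: (o x);
by elim/ord4_ind: a; elim/ord3_ind: k; congr (_, _, _); apply: val_inj.
Qed.

Lemma rho_inj : injective rho.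
Proof. by move=> d d' E; rewrite -(rho3 d) E rho3. Qed.

Lemma vert_rho d : vert (rho d) = vert d.
Proof.
case: d => [[x a] k]; rewrite /vert /rho /positive /=; case: (o x);
by elim/ord4_ind: a; elim/ord3_ind: k; apply: val_inj.
Qed.

Lemma rho_next d :
  lift (rho d).1.2 (next_ix (~~ positive (rho d).1) (rho d).2) = d.1.2.
Proof.
case: d => [[x a] k]; rewrite /rho /positive /=; case: (o x);
by elim/ord4_ind: a; elim/ord3_ind: k; apply: val_inj.
Qed.

Lemma iotaK : involutive iota.
Proof. by case=> f k; rewrite /iota /= flipK. Qed.

Lemma positive_iota d : positive (iota d).1 = ~~ positive d.1.
Proof. exact: positive_flip. Qed.

Lemma vert_iota d : vert (iota d) = gperm T d.1.1 d.1.2 (vert d).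
Proof. by rewrite /vert gperm_lift. Qed.

(** Crossing a side and then rotating turns around a corner: the cycles are the vertices of the
    link. *)
Definition tau d := rho (iota d).

Lemma tau_inj : injective tau.
Proof. exact: inj_comp rho_inj (inv_inj iotaK). Qed.

Definition tau_perm : {perm dart} := perm tau_inj.

Definition turn_flag (d : dart) : 'I_N * 'I_4 * 'I_4 :=
  (d.1, lift d.1.2 (next_ix (~~ positive d.1) d.2)).

(** A vertex of the link is an end of an edge of the triangulation. Sums around edges thus become
    sums along orbits of [tau]. *)
Lemma turn_flag_tau d : turn_flag (tau d) = turn T (turn_flag d).
Proof.
rewrite /turn_flag rho_next /tau.
case: d => [[x a] k]; rewrite /turn /= gperm_lift -(positive_flip (x, a)).
by rewrite /rho /iota /flip /=.
Qed.

Lemma turn_flag_neq d : (turn_flag d).1.2 != (turn_flag d).2.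
Proof. exact: neq_lift. Qed.

(* The curves are made of one arc in the link triangle at the vertex 1, between
   the sides on the faces 2 and 3, and one in the link triangle at the vertex 2,
   between the sides on the faces 0 and 1.  The [mixed] sides are those crossed
   by a curve: [phi] and [mu] describe the faces and edges of the link
   cut open along the curves. *)
Definition mixed (d : dart) : bool := d.2 == ord3 1.

Lemma mixed_iota d : mixed (iota d) = mixed d.
Proof. by []. Qed.

Definition phi d := rho (if mixed d then iota d else d).
Definition mu d := if mixed d then d else iota d.

Lemma phi_inj : injective phi.
Proof.
move=> d d' /rho_inj.
have [m|m] := boolP (mixed d); have [m'|m'] := boolP (mixed d') => //.
- by move/(inv_inj iotaK).
- by move=> E; move: m'; rewrite -E mixed_iota m.
- by move=> E; move: m; rewrite E mixed_iota m'.
Qed.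

Lemma muK : involutive mu.
Proof.
by move=> d; rewrite /mu; case: (boolP (mixed d)) => m; rewrite ?mixed_iota ?m ?(negbTE m) ?iotaK.
Qed.

Definition phi_perm : {perm dart} := perm phi_inj.
Definition mu_perm : {perm dart} := perm (inv_inj muK).

(** For each dart exactly one of [mu] and the following [phi] applies [iota]. This factorization is
    what Ree's inequality is applied to. *)
Lemma mu_phi : (mu_perm * phi_perm)%g = tau_perm.
Proof.
apply/permP => d; rewrite permM !permE /phi /mu.
by case: (boolP (mixed d)) => m; rewrite ?mixed_iota ?m ?(negbTE m).
Qed.

End Darts.

(** * The curves on the link *)

Section Curves.
Variables (N : nat) (T : triangulation 'I_N) (o : 'I_N -> bool).
Hypotheses (Tor : oriented T o) (Tord : ordered T).

Local Notation flag := ('I_N * 'I_4)%type.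
Local Notation dart := ('I_N * 'I_4 * 'I_3)%type.
Local Notation positive := (positive o).
Local Notation iota := (iota T).
Local Notation rho := (rho o).
Local Notation tau := (tau T o).
Local Notation phi := (phi T o).
Local Notation mu := (mu T).

Definition ord4 (n : nat) : 'I_4 :=
  match n with 0 => @Ordinal 4 0 isT | 1 => @Ordinal 4 1 isT
  | 2 => @Ordinal 4 2 isT | _ => @Ordinal 4 3 isT end%N.

(* [arc x true] is the arc at the vertex 1 of [x] and [arc x false] the one at
   the vertex 2; they are numbered so as to index the columns of a matrix. *)
Definition arc (x : 'I_N) (b : bool) : 'I_(N + N) := if b then lshift N x else rshift N x.
Definition arc_tet (v : 'I_(N + N)) : 'I_N := match split v with inl x => x | inr x => x end.
Definition arc_side (v : 'I_(N + N)) : bool := if split v is inl _ then true else false.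

Lemma arc_tetK x b : arc_tet (arc x b) = x.
Proof.
rewrite /arc_tet /arc.
by case: b; [rewrite (unsplitK (inl x)) | rewrite (unsplitK (inr x))].
Qed.

Lemma arc_sideK x b : arc_side (arc x b) = b.
Proof.
rewrite /arc_side /arc.
by case: b; [rewrite (unsplitK (inl x)) | rewrite (unsplitK (inr x))].
Qed.

Lemma arcK v : arc (arc_tet v) (arc_side v) = v.
Proof. by rewrite -[RHS]splitK /arc /arc_tet /arc_side; case: (split v). Qed.

Definition flag_arc (f : flag) : 'I_(N + N) := arc f.1 (2 <= f.2)%N.

(** An arc joins a negative face to a positive one and is directed towards the latter; adding [o]
    selects the face of the right parity. *)
Definition arc_flag (v : 'I_(N + N)) : flag :=
  (arc_tet v, ord4 ((arc_side v).*2 + o (arc_tet v))).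

Lemma positive_arc_flag v : positive (arc_flag v).
Proof. by rewrite /positive /=; case: (arc_side v); case: (o _). Qed.

Lemma arc_flagK v : flag_arc (arc_flag v) = v.
Proof.
rewrite /flag_arc /= -[RHS]arcK; congr arc.
by case: (arc_side v); case: (o _).
Qed.

Lemma flag_arcK f : positive f -> arc_flag (flag_arc f) = f.
Proof.
case: f => x a; rewrite /positive /arc_flag /flag_arc /= arc_tetK arc_sideK => /eqP <-.
by congr (_, _); elim/ord4_ind: a.
Qed.

Definition next_arc (v : 'I_(N + N)) : 'I_(N + N) := flag_arc (flip T (arc_flag v)).

(** The other end of the same arc: 0 is exchanged with 1, and 2 with 3. *)
Definition partner (f : flag) : flag := (f.1, ord4 ((2 <= f.2)%N.*2 + ~~ odd f.2)).

Lemma partnerK : involutive partner.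
Proof. by case=> x a; rewrite /partner /=; congr (_, _); elim/ord4_ind: a. Qed.

Lemma positive_partner f : positive (partner f) = ~~ positive f.
Proof.
by case: f => x a; rewrite /positive /=; case: (o x); elim/ord4_ind: a.
Qed.

Lemma flag_arc_partner f : flag_arc (partner f) = flag_arc f.
Proof. by case: f => x a; rewrite /flag_arc /=; congr arc; elim/ord4_ind: a. Qed.

Lemma next_arcE v : arc_flag (next_arc v) = partner (flip T (arc_flag v)).
Proof.
rewrite /next_arc -flag_arc_partner flag_arcK // positive_partner positive_flip //.
by rewrite positive_arc_flag.
Qed.

Lemma next_arc_inj : injective next_arc.
Proof.
move=> v w /(congr1 arc_flag); rewrite !next_arcE => /(inv_inj partnerK).
by move/(inv_inj (@flipK _ T)) => E; rewrite -(arc_flagK v) E arc_flagK.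
Qed.

Definition arc_perm : 'S_(N + N) := perm next_arc_inj.

(** A link edge crossed by a curve is cut into two halves, one for each of its darts; the boolean
    tells on which side of the curve the half lies. *)
Definition side_dart (s : 'I_(N + N) * bool) : dart :=
  ((if s.2 then arc_flag s.1 else flip T (arc_flag s.1)), ord3 1).

Definition dart_side (d : dart) : 'I_(N + N) * bool :=
  (flag_arc (if positive d.1 then d.1 else flip T d.1), positive d.1).

Lemma side_dartK : cancel side_dart dart_side.
Proof.
case=> v b; rewrite /dart_side /side_dart /=.
case: b; rewrite ?positive_flip // positive_arc_flag /= ?flipK ?arc_flagK //.
Qed.

Lemma dart_sideK d : mixed d -> side_dart (dart_side d) = d.
Proof.
case: d => f k /eqP /= ->; rewrite /dart_side /side_dart /=; congr (_, _).
case: (boolP (positive f)) => [pf|npf]; first exact: flag_arcK.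
by rewrite flag_arcK ?flipK // positive_flip.
Qed.

Lemma iota_side v b : iota (side_dart (v, b)) = side_dart (v, ~~ b).
Proof. by case: b; rewrite /side_dart /iota /= ?flipK. Qed.

(** The boundary runs in opposite directions on the two sides of a curve, whence the inverse
    permutation on the negative side. *)
Lemma side_next v b : side_dart ((if b then arc_perm else arc_perm^-1%g) v, b)
  = (partner (iota (side_dart (v, b))).1, ord3 1).
Proof.
rewrite iota_side; case: b; rewrite /side_dart /=; congr (_, _).
  by rewrite permE next_arcE.
set w := (arc_perm^-1)%g v; have -> : v = next_arc w by rewrite -[v](permKV arc_perm) permE.
by rewrite next_arcE partnerK.
Qed.

Definition strip (d : dart) : bool := (vert d != ord4 0) && (vert d != ord4 3).

Lemma strip_rho d : strip (rho d) = strip d.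
Proof. by rewrite /strip vert_rho. Qed.

Lemma mixed_strip d : mixed d -> strip d.
Proof. by case: d => [[x a] k] /eqP /= ->; elim/ord4_ind: a. Qed.

Lemma rho_mixed d : strip d -> ~~ mixed d -> mixed (rho d).
Proof.
case: d => [[x a] k]; rewrite /strip /vert /mixed /rho /positive /=; case: (o x);
by elim/ord4_ind: a; elim/ord3_ind: k.
Qed.

Lemma rho_partner d : mixed d ->
  (partner d.1, ord3 1) = if mixed (rho d) then rho d else rho (rho d).
Proof.
case: d => [[x a] k] /eqP /= ->; rewrite /partner /mixed /rho /positive /=; case: (o x);
by elim/ord4_ind: a; congr (_, _, _); apply: val_inj.
Qed.

Definition first_mixed d := if mixed d then d else rho d.

(* Distinguishes the orbits of [phi]: they are the link triangles without arc and
   the two sides of each cycle of arcs. *)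
Definition boundary_label (d : dart) :
    ('I_N * bool + {set 'I_(N + N)} * bool)%type :=
  if strip d then
    let s := dart_side (first_mixed d) in inr (porbit arc_perm s.1, s.2)
  else inl (d.1.1, vert d == ord4 3).

(** From a mixed dart, [phi] leads to the far end of the next arc, directly or through the unmixed
    third side of the triangle. Either way it stays on the same side of the same cycle of arcs. *)
Lemma boundary_label_phi d : boundary_label (phi d) = boundary_label d.
Proof.
rewrite /phi; case: ifPn => md; last first.
  rewrite /boundary_label strip_rho; case: ifPn => sd; last first.
    by rewrite vert_rho; case: d {md sd} => [[x a] k].
  by rewrite /first_mixed rho_mixed // (negbTE md).
rewrite /boundary_label strip_rho mixed_strip ?mixed_iota // mixed_strip // /first_mixed md.
rewrite -rho_partner ?mixed_iota //.
rewrite -{1 2}[d]dart_sideK //; case: (dart_side d) => v b.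
rewrite -side_next side_dartK /=; congr (inr (_, _)).
apply/eqP; rewrite eq_porbit_mem; case: b; first by rewrite porbitS ?porbit_id.
by rewrite porbit_sym -{1}[v](permKV arc_perm) porbitS ?porbit_id.
Qed.

Lemma boundary_label_tri x (b : bool) :
  boundary_label (x, ord4 (~~ b), ord3 b.*2) = inl (x, b).
Proof. by rewrite /boundary_label /strip /vert; case: b. Qed.

Lemma boundary_label_side s :
  boundary_label (side_dart s) = inr (porbit arc_perm s.1, s.2).
Proof.
have m : mixed (side_dart s) by rewrite /mixed eqxx.
by rewrite /boundary_label mixed_strip // /first_mixed m side_dartK.
Qed.

Lemma card_image_porbits (F K : finType) (s : {perm F}) (g : F -> K) :
  (forall z, g (s z) = g z) -> (#|g @: F| <= #|porbits s|)%N.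
Proof.
move=> gs; pose h (O : {set F}) := [set g z | z in O].
apply: (@leq_trans #|h @: porbits s|); last exact: leq_imset_card.
have -> : h @: porbits s = [set [set k] | k in g @: F].
  rewrite -!imset_comp; apply: eq_imset => z /=; apply/setP => k; rewrite inE.
  apply/imsetP/eqP => [[u uz ->]|->]; first exact: (porbit_eqP gs).
  by exists z; rewrite ?porbit_id.
by rewrite card_imset //; exact: set1_inj.
Qed.

(** A lower bound suffices for this and the next two counts, since Ree's inequality bounds the total
    number of cycles from above. *)
Lemma porbits_phi :
  (N.*2 + #|porbits arc_perm|.*2 <= #|porbits (phi_perm T o)|)%N.
Proof.
have inv z : boundary_label (phi_perm T o z) = boundary_label z.
  by rewrite permE boundary_label_phi.
apply: leq_trans (card_image_porbits inv).
pose A : {set 'I_N * bool} := setT; pose B := setX (porbits arc_perm) [set: bool].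
have -> : (N.*2 + #|porbits arc_perm|.*2 = #|[set inl a | a in A] :|: [set inr b | b in B]|)%N.
  rewrite cardsU disjoint_setI0 ?cards0 ?subn0; last first.
    by apply/pred0P => u /=; apply/negP => /andP[/imsetP[u1 _ ->] /imsetP[u2 _ //]].
  rewrite (card_imset A) => [|? ? []//]; rewrite (card_imset B) => [|? ? []//].
  by rewrite /A /B cardsT card_prod card_ord cardsX cardsT card_bool !muln2.
apply/subset_leq_card/subUsetP; split; apply/subsetP => _ /imsetP[[u b] h ->].
  by apply/imsetP; exists (u, ord4 (~~ b), ord3 b.*2); rewrite ?boundary_label_tri.
move: h; rewrite inE => /andP[/imsetP[v _ /= ->] _].
by apply/imsetP; exists (side_dart (v, b)); rewrite ?boundary_label_side.
Qed.
End Curves.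

(** * Cycle counts and the Euler characteristic of the link *)

Section LinkCount.
Variables (N : nat) (T : triangulation 'I_N) (o : 'I_N -> bool).
Hypotheses (Tor : oriented T o) (Tord : ordered T).

Local Notation dart := ('I_N * 'I_4 * 'I_3)%type.
Local Notation corner := ('I_N * 'I_4 * 'I_4)%type.

(** The [4N] mixed darts are fixed and the [8N] others are exchanged in pairs. *)
Lemma porbits_mu : (N * 8 <= #|porbits (mu_perm T)|)%N.
Proof.
pose g (d : dart) := if mixed d || positive o d.1 then d else iota T d.
have inv z : g (mu_perm T z) = g z.
  rewrite permE /mu; case: (boolP (mixed z)) => m //.
  rewrite /g mixed_iota (negbTE m) positive_iota //.
  by case: (positive o z.1) => //=; rewrite iotaK.
apply: leq_trans (card_image_porbits inv).
(* One dart per cycle: the positive darts of all three indices and the negative ones of index 1. The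
   slot left free by a negative flag holds index 2 at its positive partner. *)
pose r (u : 'I_N * 'I_4 * bool) : dart :=
  let: (x, a, b) := u in
  if positive o (x, a) then (x, a, ord3 b)
  else if b then (x, a, ord3 1) else (partner (x, a), ord3 2).
have rinj : injective r.
  case=> [[x a] b] [[y a'] b']; rewrite /r /partner /positive /=.
  case: (odd a == o x) / boolP => p; case: (odd a' == o y) / boolP => p';
  case: b; case: b' => //= -[] xy; subst y => //.
  - by move=> ->.
  - by move=> ->.
  - by move=> aa; move: p p'; rewrite aa; case: (_ == _).
  - by move=> aa; move: p p'; rewrite aa; case: (_ == _).
  - by move=> ->.
  - by move: p p'; case: (o x); elim/ord4_ind: a; elim/ord4_ind: a'.
have -> : (N * 8 = #|r @: [set: 'I_N * 'I_4 * bool]|)%N.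
  by rewrite card_imset // cardsT !card_prod !card_ord card_bool -mulnA.
apply/subset_leq_card/subsetP => _ /imsetP[[[x a] b] _ ->].
apply/imsetP; exists (r (x, a, b)) => //; rewrite /g /mixed /=.
case: (boolP (positive o (x, a))) => p /=; first by rewrite p orbT.
by case: b => //=; rewrite -/(partner (x, a)) positive_partner p.
Qed.

(* The corner between the sides [d] and [rho^-1 d] of the same link triangle. *)
Definition corner_of (d : dart) : corner :=
  (d.1.1, vert d, lift d.1.2 (next_ix (positive o d.1) d.2)).

Lemma link_corner_sym : symmetric (link_corner_glue T).
Proof.
suff S p q : link_corner_glue T p q -> link_corner_glue T q p.
  by move=> p q; apply/idP/idP; exact: S.
case: p q => [[x v] u] [[x' v'] u'] /existsP[a /and3P[av au /eqP[-> -> ->]]].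
apply/existsP; exists (gperm T x a a); rewrite !(inj_eq perm_inj) av au /=.
by rewrite adjK gpermK !permK.
Qed.

Lemma corner_of_tau d : link_corner_glue T (corner_of d) (corner_of (tau T o d)).
Proof.
rewrite /corner_of /= /tau; apply/existsP; exists d.1.2.
rewrite vert_rho vert_iota //.
rewrite !neq_lift /=; case: d => [[x a] k] /=; rewrite gperm_lift //.
apply/eqP; congr (_, _, _).
rewrite /iota /rho /flip /=.
have := positive_flip Tor Tord (x, a); rewrite /flip /=.
move: (adj T x a) (gperm T x a a) => y b; rewrite /positive /=.
case: (odd a == o x) => /=; case: (o y).
all: by elim/ord4_ind: b => //= _; elim/ord3_ind: k; apply: val_inj.
Qed.

Lemma corner_of_surj x (v u : 'I_4) : u != v -> exists d, corner_of d = (x, v, u).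
Proof.
move=> uv; suff [[a k] /= /andP[/eqP E1 /eqP E2]] : exists ak : 'I_4 * 'I_3,
    (lift ak.1 ak.2 == v) && (lift ak.1 (next_ix (odd ak.1 == o x) ak.2) == u).
  by exists (x, a, k); rewrite /corner_of /vert /positive /= E1 E2.
have C (a : 'I_4) (k : 'I_3) : (lift a k == v) && (lift a (next_ix (odd a == o x) k) == u) ->
  exists ak : 'I_4 * 'I_3, (lift ak.1 ak.2 == v) &&
    (lift ak.1 (next_ix (odd ak.1 == o x) ak.2) == u).
  by exists (a, k).
move: uv C; case: (o x); elim/ord4_ind: v; elim/ord4_ind: u => // _ C.
all: (by apply: (C (ord4 0) (ord3 0)))||(by apply: (C (ord4 0) (ord3 1)))
 ||(by apply: (C (ord4 0) (ord3 2)))||(by apply: (C (ord4 1) (ord3 0)))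
 ||(by apply: (C (ord4 1) (ord3 1)))||(by apply: (C (ord4 1) (ord3 2)))
 ||(by apply: (C (ord4 2) (ord3 0)))||(by apply: (C (ord4 2) (ord3 1)))
 ||(by apply: (C (ord4 2) (ord3 2)))||(by apply: (C (ord4 3) (ord3 0)))
 ||(by apply: (C (ord4 3) (ord3 1)))||(by apply: (C (ord4 3) (ord3 2))).
Qed.

Lemma porbits_tau_corner :
  (n_comp (link_corner_glue T) [pred p | p.1.2 != p.2] <= #|porbits (tau_perm T o)|)%N.
Proof.
pose e := link_corner_glue T; have se : connect_sym e.
  exact/sym_connect_sym/link_corner_sym.
pose g d := fingraph.root e (corner_of d).
have inv z : g (tau_perm T o z) = g z.
  rewrite permE /g; apply/esym/eqP; rewrite (root_connect se); apply: connect1.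
  exact: corner_of_tau.
apply: leq_trans (card_image_porbits inv).
apply/subset_leq_card/subsetP => -[[x v] u] /andP[/eqP rp vu].
have [d dE] := @corner_of_surj x v u ltac:(by rewrite eq_sym).
by apply/imsetP; exists d => //; rewrite /g dE rp.
Qed.

(** The [12N] sides are glued in pairs, and each pair has exactly one member on a positive face. *)
Lemma link_side_count : (N * 6 <= n_comp (link_side_glue T) [pred p | p.1.2 != p.2])%N.
Proof.
pose e := link_side_glue T.
pose f (p : corner) : corner := (adj T p.1.1 p.2, gperm T p.1.1 p.2 p.1.2, gperm T p.1.1 p.2 p.2).
have fK : involutive f by case=> [[x v] a]; rewrite /f /= adjK gpermK !permK.
have eE p q : e p q = (q == f p) by case: p q => [[x v] a] [[y w] b].
have es : symmetric e by move=> p q; rewrite !eE -(inv_eq fK) eq_sym.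
have se : connect_sym e by exact: sym_connect_sym.
pose g (p : corner) := if positive o (p.1.1, p.2) then p else f p.
have pf (p : corner) : positive o ((f p).1.1, (f p).2) = ~~ positive o (p.1.1, p.2).
  by rewrite -(positive_flip Tor Tord).
have gf p : g (f p) = g p.
  by rewrite /g pf; case: (positive o _) => /=; rewrite ?fK.
have gc p q : connect e p q -> g p = g q.
  case/connectP => s; elim: s p => [|z s IH] p /=; first by move=> _ ->.
  by rewrite eE => /andP[/eqP-> /IH{}IH /IH]; rewrite gf.
pose pos x (b : bool) : 'I_4 := ord4 (b.*2 + o x).
have posP x b : positive o (x, pos x b) by rewrite /positive /pos /=; case: b; case: (o x).
pose r (u : 'I_N * bool * 'I_3) : corner :=
  let a := pos u.1.1 u.1.2 in (u.1.1, lift a u.2, a).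
have rinj : injective (fingraph.root e \o r).
  case=> [[x b] k] [[y b'] k'] /= /eqP; rewrite (root_connect se) => /gc.
  rewrite /g /r /= !posP => -[xy]; subst y => kk bb.
  have {}bb : b = b' by move: bb; rewrite /pos; case: b {kk}; case: b'; case: (o x).
  subst b'; congr (_, _, _).
  by apply: (@lift_inj _ (pos x b)); apply: val_inj.
have -> : (N * 6 = #|(fingraph.root e \o r) @: [set: 'I_N * bool * 'I_3]|)%N.
  by rewrite card_imset // cardsT !card_prod !card_ord card_bool -mulnA.
apply/subset_leq_card/subsetP => _ /imsetP[u _ ->] /=.
rewrite !inE (roots_root se) /=.
have cl : closed e [pred p | p.1.2 != p.2].
  by move=> p q; rewrite eE => /eqP ->; rewrite !inE /= (inj_eq perm_inj).
have := closed_connect cl (connect_root e (r u)).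
by rewrite !inE /= => <-; rewrite eq_sym neq_lift.
Qed.

(** With [4N] triangles and at least [6N] edges, zero Euler characteristic forces at least [2N]
    vertices. *)
Lemma porbits_tau : torus_link T -> (N.*2 <= #|porbits (tau_perm T o)|)%N.
Proof.
case=> _; rewrite /link_euler card_prod !card_ord => eul.
have := porbits_tau_corner; have := link_side_count; move: eul.
move: (n_comp _ _) (n_comp _ _) => V E; lia.
Qed.

End LinkCount.

(** * Sums of a cocycle along the curves *)

Section CurveSums.
Variables (N : nat) (T : triangulation 'I_N) (o : 'I_N -> bool).
Hypotheses (Tor : oriented T o) (Tord : ordered T) (Tlink : torus_link T).

Local Notation dart := ('I_N * 'I_4 * 'I_3)%type.
Local Notation iota := (iota T).
Local Notation rho := (rho o).
Local Notation kappa := (arc_perm Tor Tord).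

Lemma same_triangle x a k a' k' :
  vert ((x, a, k) : dart) = vert ((x, a', k') : dart) ->
  [|| (x, a', k') == (x, a, k), (x, a', k') == rho (x, a, k)
    | (x, a', k') == rho (rho (x, a, k))].
Proof.
rewrite /vert /rho /positive /= => /(congr1 val) /=; case: (o x);
elim/ord4_ind: a; elim/ord3_ind: k; elim/ord4_ind: a'; elim/ord3_ind: k' => //=;
by rewrite !xpair_eqE eqxx.
Qed.

Lemma dart_connected (P : dart -> Prop) :
  (forall d, P d -> P (rho d)) -> (forall d, P d -> P (iota d)) ->
  forall d d', P d -> P d'.
Proof.
move=> Prho Piota.
have tri d d' : d.1.1 = d'.1.1 -> vert d = vert d' -> P d -> P d'.
  case: d d' => [[x a] k] [[y a'] k'] /= <- /same_triangle.
  by case/or3P => /eqP -> h; [exact: h | exact: Prho | exact/Prho/Prho].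
move=> d d' Pd; case: Tlink => /(_ (d.1.1, vert d) (d'.1.1, vert d')) + _.
case/connectP => s; elim: s d Pd => [|p s IH] d Pd /=.
  by move=> _ [e1 e2]; apply: tri Pd; [|apply: val_inj].
case/andP=> /existsP[a /andP[/= av /eqP pE]] sp lst.
have [k kE _] := unlift_some av.
have P1 : P (iota (d.1.1, a, k)) by apply/Piota/(tri d).
have E : ((iota (d.1.1, a, k)).1.1, vert (iota (d.1.1, a, k))) = p.
  by rewrite vert_iota // pE /vert /= -kE.
by apply: (IH _ P1); rewrite E.
Qed.

Variable c : 'I_N * 'I_4 -> int.
Hypothesis c_flip : forall f, c (flip T f) = - c f.
Hypothesis c_turn : forall f l, f.1.2 != f.2 -> iter l (turn T) f = f ->
  \sum_(i < l) c (iter i (turn T) f).1 = 0.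

(** [c] is a 1-cocycle of the dual complex. A curve leaves each of its arcs through the positive
    end, so this is the value of [c] on the curve. *)
Definition curve_sum (O : {set 'I_(N + N)}) : int := \sum_(v in O) c (arc_flag o v).

Section Label.
Variable f : dart -> dart.
Hypotheses (f_phi : forall d, f (phi T o d) = f d) (f_mu : forall d, f (mu T d) = f d).

(** Along either side, [phi] joins consecutive arcs in one or two steps. *)
Lemma label_side v b : f (side_dart T o (kappa v, b)) = f (side_dart T o (v, b)).
Proof.
have step d : mixed d -> f (partner (iota d).1, ord3 1) = f d.
  move=> md; rewrite (rho_partner o) ?mixed_iota //.
  have E : rho (iota d) = phi T o d by rewrite /phi md.
  case: ifPn => m; first by rewrite E f_phi.
  by rewrite -[RHS]f_phi -E -[RHS]f_phi /phi (negbTE m).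
have md w b' : mixed (side_dart T o (w, b')) by rewrite /mixed eqxx.
case: b; first by rewrite -(step (side_dart T o (v, true))) // -side_next.
rewrite -(step (side_dart T o (kappa v, false))) // -(side_next Tor Tord).
by rewrite permK.
Qed.

Lemma label_tau d : f (tau T o d) = f d.
Proof.
have := mu_phi T o => /permP/(_ d); rewrite permM !permE => <-.
by rewrite f_phi f_mu.
Qed.

(** A class of [f] is a union of cycles of [tau], and [c] sums to zero around each of them. *)
Lemma label_sum k : \sum_(d : dart | f d == k) c d.1 = 0.
Proof.
set S := \sum_(d | _) _; pose m := #[tau_perm T o]%g.
have shift l : \sum_(d : dart | f d == k) c (iter l (tau T o) d).1 = S.
  rewrite /S [RHS](reindex_inj (h := iter l (tau T o))) /=; last first.
    by elim: l => //= l IH d d' /tau_inj/IH.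
  have fl d : f (iter l (tau T o) d) = f d by elim: l => //= l IH; rewrite label_tau.
  by apply: eq_big => [d|d _ //]; rewrite fl.
(* Averaging over the powers of [tau_perm] below its order avoids splitting into cycles. An orbit
   may go several times around its edge, which [c_turn] permits. *)
have : m%:R * S = \sum_(l < m) \sum_(d : dart | f d == k) c (iter l (tau T o) d).1.
  rewrite (eq_bigr (fun=> S)) => [|l _]; last exact: shift.
  by rewrite sumr_const card_ord mulr_natl.
rewrite exchange_big /= big1 => [/eqP|d _].
  rewrite mulf_eq0 => /orP[|/eqP//].
  by rewrite pnatr_eq0 /m -leqn0 leqNgt order_gt0.
have E l : turn_flag o (iter l (tau T o) d) = iter l (turn T) (turn_flag o d).
  by elim: l => //= l <-; rewrite turn_flag_tau.
rewrite -[RHS](c_turn (f := turn_flag o d) (l := m)).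
- by apply: eq_bigr => l _; rewrite -E.
- exact: turn_flag_neq.
rewrite -E; congr (turn_flag o _).
have -> : iter m (tau T o) d = (tau_perm T o ^+ m)%g d.
  elim: m => [|l IH]; first by rewrite expg0 perm1.
  by rewrite expgSr permM -IH permE.
by rewrite expg_order perm1.
Qed.

(** Stokes' theorem on a piece of the cut link: its unmixed darts cancel in pairs under [iota], and
    only the sides of curves remain. *)
Lemma label_sum_sides k :
  \sum_(s : 'I_(N + N) * bool | f (side_dart T o s) == k) c (side_dart T o s).1 = 0.
Proof.
have M s : mixed (side_dart T o s) by rewrite /mixed eqxx.
have md0 : \sum_(d : dart | (f d == k) && ~~ mixed d) c d.1 = 0.
  set S := \sum_(d | _) _.
  suff : S = - S by lia.
  rewrite {1}/S (reindex_inj (inv_inj (@iotaK _ T))) /= -sumrN.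
  apply: eq_big => [d|d _]; last by rewrite c_flip.
  rewrite mixed_iota; case: (boolP (mixed d)) => m; first by rewrite !andbF.
  by rewrite -(f_mu d) /mu (negbTE m).
rewrite -[RHS](label_sum k) [RHS](bigID (@mixed N)) /= md0 addr0.
rewrite [RHS](reindex (side_dart T o)) /=; last first.
  exists (dart_side T o) => [s _|d /andP[_ md]].
    exact: side_dartK.
  exact: dart_sideK.
by apply: eq_bigl => s; rewrite M andbT.
Qed.
End Label.

(** Ree's inequality gives at least half as many pieces of the cut link as there are sides of
    curves. By [fibre_absz] each piece has two sides, with opposite sums, and connectedness of the
    link carries the absolute value from piece to piece. *)
Lemma curve_sum_absz :
  (forall O, O \in porbits kappa -> curve_sum O != 0) ->
  {in porbits kappa &, forall O O', `|curve_sum O|%N = `|curve_sum O'|%N}.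
Proof.
move=> n0 O0 O1 O0P O1P.
have [f [f_phi' f_mu' le]] := ree (phi_perm T o) (mu_perm T).
have f_phi d : f (phi T o d) = f d by rewrite -[RHS]f_phi' permE.
have f_mu d : f (mu T d) = f d by rewrite -[RHS]f_mu' permE.
pose A := setX (porbits kappa) [set: bool].
pose Q := [set f z | z : dart].
have [v0 _ O0E] := imsetP O0P.
(* The piece on the given side of a curve, read at any of its arcs; the default [v0] only serves the
   empty set. *)
pose q (s : {set 'I_(N + N)} * bool) : dart :=
  f (side_dart T o (odflt v0 [pick v in s.1], s.2)).
pose n (s : {set 'I_(N + N)} * bool) := (-1) ^+ (~~ s.2) * curve_sum s.1.
have fs b v w : w \in porbit kappa v -> f (side_dart T o (w, b)) = f (side_dart T o (v, b)).
  by apply: (porbit_eqP (f := fun u => f (side_dart T o (u, b)))) => u; exact: label_side.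
have qE v b : q (porbit kappa v, b) = f (side_dart T o (v, b)).
  rewrite /q /=; case: pickP => [w /fs->//|/(_ v)].
  by rewrite porbit_id.
have nabs s : `|n s|%N = `|curve_sum s.1|%N.
  by rewrite /n abszM abszX; case: s.2; rewrite ?expr0 ?mul1n.
have AP v b : (porbit kappa v, b) \in A.
  by rewrite !inE andbT; apply/imsetP; exists v.
have leA : (#|A| <= #|Q|.*2)%N.
  rewrite cardsX cardsT card_bool muln2.
  move: le; rewrite mu_phi !card_prod !card_ord.
  (* Ree's inequality for [12N] darts: the lower bounds [2N + 2k], [8N] and [2N] use up every term
     in [N]. *)
  have ar a b t k p : (N.*2 + k.*2 <= a -> N * 8 <= b -> N.*2 <= t ->
    a + b + t <= N * 4 * 3 + p.*2 -> k.*2 <= p.*2)%N by lia.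
  apply: ar; [exact: porbits_phi | exact: (porbits_mu Tor) | exact: porbits_tau].
have mS s : mixed (side_dart T o s) by rewrite /mixed eqxx.
have surj k : k \in Q -> exists2 s, s \in A & q s = k.
  case/imsetP => d0 _ kE.
  case: (pickP [pred d | (f d == k) && mixed d]) => [d /andP[/eqP dk md]|none].
    rewrite -[d](dart_sideK Tor Tord) // in dk; case: (dart_side T o d) dk => v b dk.
    by exists (porbit kappa v, b); rewrite ?qE.
  (* A piece that meets no curve is stable under [rho] and [iota], hence is the whole link, which
     contains the curve through [v0]. *)
  have nm d : f d = k -> mixed d = false.
    by move=> dk; have := none d; rewrite /= dk eqxx.
  have hr d : f d = k -> f (rho d) = k by move=> dk; rewrite -dk -[RHS]f_phi /phi nm.
  have hi d : f d = k -> f (iota d) = k by move=> dk; rewrite -dk -[RHS]f_mu /mu nm.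
  have := nm _ (dart_connected hr hi (side_dart T o (v0, true)) (esym kE)).
  by rewrite mS.
have AQ s : s \in A -> q s \in Q by move=> _; exact: imset_f.
have nn0 s : s \in A -> n s != 0.
  by rewrite inE => /andP[/n0 h _]; rewrite -absz_eq0 nabs absz_eq0.
have sum0 k : \sum_(s in A | q s == k) n s = 0.
  rewrite -[RHS](label_sum_sides f_phi f_mu k).
  pose p (s : 'I_(N + N) * bool) := (porbit kappa s.1, s.2).
  rewrite [RHS](partition_big p (fun s => (s \in A) && (q s == k))) /=; last first.
    by case=> v b vb; apply/andP; split; [exact: AP | rewrite qE].
  apply: eq_bigr => -[O b] /andP[]; rewrite !inE /= andbT => /imsetP[v _ ->].
  rewrite qE => /eqP vk; rewrite /n /curve_sum mulr_sumr.
  rewrite [RHS](reindex_onto (fun v => (v, b)) fst) /=; last first.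
    by case=> w b'; rewrite /p xpair_eqE => /and3P[_ _ /eqP /= ->].
  apply: eq_big => [w|w _]; last first.
    by rewrite /side_dart /=; case: b {vk}; rewrite /= ?expr0 ?mul1r // expr1 mulN1r c_flip.
  rewrite /p xpair_eqE /= eqxx !andbT eq_porbit_mem; case: (boolP (w \in _)) => wv.
    by rewrite (fs _ _ _ wv) vk !eqxx.
  by rewrite andbF.
have main := fibre_absz leA surj AQ nn0 sum0.
(* All sides of curves in the piece of [d] have the absolute value of [O0]. Crossing a curve
   preserves this, as its two sides differ only by a sign. *)
pose P d := forall s, s \in A -> q s = f d -> `|n s|%N = `|n (O0, true)|%N.
have O0A b : (O0, b) \in A by rewrite O0E AP.
have Pf d d' : f d = f d' -> P d -> P d' by move=> E Pd s sA sE; apply: Pd; rewrite // E.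
have Piota d : P d -> P (iota d).
  case: (boolP (mixed d)) => md; last by apply: Pf; rewrite -[LHS]f_mu /mu (negbTE md).
  rewrite -[d](dart_sideK Tor Tord) //; case: (dart_side T o d) => v b Pd s sA.
  rewrite iota_side // -qE => /main -> //; rewrite -(Pd (porbit kappa v, b)) ?qE //.
  by rewrite !nabs.
have Prho d : P d -> P (rho d).
  case: (boolP (mixed d)) => md; last by apply: Pf; rewrite -[LHS]f_phi /phi (negbTE md).
  by move/Piota; apply: Pf; rewrite -[LHS]f_phi /phi mixed_iota md iotaK.
have [v1 _ O1E] := imsetP O1P.
have P0 : P (side_dart T o (v0, true)).
  by move=> s sA sE; apply: main => //; rewrite sE O0E qE.
have := dart_connected Prho Piota (side_dart T o (v1, true)) P0.
by move=> /(_ (O1, true)); rewrite !nabs /= => -> //; rewrite O1E ?AP ?qE.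
Qed.

End CurveSums.

(** * Heights on the universal cover *)

Section Height.
Variables (N : nat) (T : triangulation 'I_N) (x0 : 'I_N).
Local Notation Tc := (Defs.cover T x0).
Local Notation pi := (pi1 T x0).
Local Notation cT := (cover_triangulation T x0).

Lemma deck_transitive (p q : Tc) : cproj p = cproj q -> exists g : pi, deck g p = q.
Proof.
move=> pq; pose u := path_repr q ++ walk_rev T x0 (path_repr p).
have cu : cproj (path_class T x0 u : Tc) == x0.
  by rewrite cproj_class walk_cat -/(cproj q) -pq walk_revK.
exists (exist (fun p : Tc => cproj p == x0) _ cu).
rewrite -{1}[p]path_reprK (deck_class (u := u)) // -[RHS]path_reprK.
apply/path_classP; rewrite /u -catA -[X in homotopic _ _ _ X]cats0.
apply: homotopic_catl; rewrite -/(cproj q) -pq.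
exact: homotopic_revl.
Qed.

Lemma cadj_deck (g : pi) (p : Tc) a : cadj (deck g p) a = deck g (cadj p a).
Proof.
rewrite /cadj (deck_class (u := path_repr (val g))) ?path_reprK //.
apply/path_classP; rewrite -!cats1 catA; apply: homotopic_catr.
exact: path_repr_class.
Qed.

Variable alpha : pi -> int.
Hypothesis alphaM : {morph alpha : g h / (g * h)%g >-> g + h}.
Variable base : 'I_N -> Tc.
Hypothesis baseP : forall j, cproj (base j) = j.

(** Every tetrahedron of the cover is a unique translate of a base one; its height is [alpha] of the
    translation. *)
Lemma height_exists : exists h : Tc -> int,
  (forall g p, h (deck g p) = alpha g + h p) /\ (forall j, h (base j) = 0).
Proof.
have /choice[k kP] (p : Tc) : exists g : pi, deck g (base (cproj p)) = p.
  by apply: deck_transitive; rewrite baseP.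
have a1 : alpha 1%g = 0.
  by have := alphaM 1%g 1%g; rewrite mul1g => /eqP; rewrite -subr_eq0 opprD addNKr oppr_eq0 => /eqP.
exists (alpha \o k); split=> [g p|j] /=.
  rewrite -alphaM; congr alpha; apply: (@deck_inj _ _ _ (base (cproj p))).
  rewrite deck_mul kP -[X in deck _ (base X)](cproj_deck g p).
  exact: kP.
rewrite -[RHS]a1; congr alpha; apply: (@deck_inj _ _ _ (base j)).
by rewrite deck_one; have := kP (base j); rewrite baseP.
Qed.

End Height.

Section HeightTheory.
Variables (N : nat) (T : triangulation 'I_N) (x0 : 'I_N).
Local Notation Tc := (Defs.cover T x0).
Local Notation pi := (pi1 T x0).
Local Notation cT := (cover_triangulation T x0).
Variables (alpha : pi -> int) (base : 'I_N -> Tc).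
Hypothesis baseP : forall j, cproj (base j) = j.
Variable h : Tc -> int.
Hypothesis hD : forall g p, h (deck g p) = alpha g + h p.

(** At most one deck transformation carries [p] to [q i], and its image under [alpha] is the
    difference of heights. The entries of all the twisted matrices are evaluated in this way. *)
Lemma twist_sum (I : eqType) (s : seq I) (n : I -> int) (q : I -> Tc) (p : Tc)
    (r : group_ring T x0) :
  (forall g, r g = \sum_(i <- s) n i * (deck g p == q i)%:Z) ->
  twist alpha r =
    \sum_(i <- s) (n i)%:~R * (cproj p == cproj (q i))%:R * tvar ^ (h (q i) - h p).
Proof.
move=> rE.
have /choice[k kP] (i : I) : exists g : pi, cproj p = cproj (q i) -> deck g p = q i.
  have [e|e] := eqVneq (cproj p) (cproj (q i)).
    by have [g gE] := deck_transitive e; exists g.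
  by exists 1%g => /eqP; rewrite (negbTE e).
have kE g i : deck g p = q i -> g = k i.
  move=> gq; apply: (@deck_inj _ _ _ p); rewrite kP //.
  by rewrite -gq cproj_deck.
pose R := undup (map k s).
rewrite /twist (fsbigE R) ?undup_uniq //; last first.
  move=> g _ gR; rewrite rE big_seq big1 ?mul0r // => i si.
  case: eqP => [/kE gE|_]; last by rewrite mulr0.
  by case/negP: gR; rewrite mem_undup gE map_f.
under eq_bigl => g do rewrite classical_sets.in_setT.
under eq_bigr => g _ do rewrite rE rmorph_sum /= mulr_suml.
rewrite exchange_big /= big_seq [RHS]big_seq; apply: eq_bigr => i si.
have [e|e] := eqVneq (cproj p) (cproj (q i)); last first.
  rewrite mulr0 mul0r big1 // => g _; case: eqP => [gq|_]; last by rewrite mulr0 mul0r.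
  by case/eqP: e; rewrite -gq cproj_deck.
rewrite mulr1 (bigD1_seq (k i)) ?undup_uniq //=; last by rewrite mem_undup map_f.
rewrite kP // eqxx mulr1 big1 ?addr0 => [|g gk].
  by rewrite -{1}(kP i e) hD addrK.
case: eqP => [/kE gE|_]; last by rewrite mulr0 mul0r.
by rewrite gE eqxx in gk.
Qed.

(** By equivariance the change of height depends only on the projected face: this is a cocycle of
    the dual complex representing [alpha]. *)
Definition crossing (f : 'I_N * 'I_4) : int := h (cadj (base f.1) f.2) - h (base f.1).

Lemma crossingE p a : h (cadj p a) - h p = crossing (cproj p, a).
Proof.
have [g <-] := deck_transitive (baseP (cproj p)).
by rewrite cproj_deck cadj_deck !hD /crossing /= baseP; lia.
Qed.

Lemma crossing_flip f : crossing (flip T f) = - crossing f.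
Proof.
case: f => x a; have := crossingE (base x) a; have := crossingE (cadj (base x) a) (gperm T x a a).
have := cadjK (base x) a; rewrite /cgperm cproj_cadj baseP => -> <- <-; lia.
Qed.

Lemma iter_cturn_proj (p : Tc) c d l :
  let f := iter l (turn cT) (p, c, d) in
  (cproj f.1.1, f.1.2, f.2) = iter l (turn T) (cproj p, c, d).
Proof. exact: (iter_turn_proj l (p, c, d)). Qed.

Lemma crossing_iter (p : Tc) c d l :
  \sum_(i < l) crossing (iter i (turn T) (cproj p, c, d)).1
    = h (iter l (turn cT) (p, c, d)).1.1 - h p.
Proof.
elim: l => [|l IH]; first by rewrite big_ord0 subrr.
rewrite big_ord_recr /= IH -iter_cturn_proj /= -crossingE.
by case: (iter l _ _) => [[q a] b] /=; lia.
Qed.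

(** A loop around an edge is null-homotopic, so its lift closes up. A return after [l] turns makes
    [l] a multiple of the order, so that the lift of these turns closes up too. *)
Lemma crossing_turn f l : f.1.2 != f.2 -> iter l (turn T) f = f ->
  \sum_(i < l) crossing (iter i (turn T) f).1 = 0.
Proof.
case: f => [[x c] d] /= cd fl.
rewrite -(baseP x) crossing_iter; apply/eqP; rewrite subr_eq0; apply/eqP.
congr h; rewrite (_ : iter l _ _ = (base x, c, d)) //.
set n := fingraph.order (turn T) (x, c, d).
have per m : iter (m * n) (turn cT) (base x, c, d) = (base x, c, d).
  elim: m => // m IHm; rewrite mulSn addnC iterD /n -{1 2}(baseP x) iter_turn_order //.
  by rewrite baseP.
have perT m : iter (m * n) (turn T) (x, c, d) = (x, c, d).
  by rewrite -{1}(baseP x) -iter_cturn_proj per /= baseP.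
have n0 : (0 < n)%N by exact: fingraph.order_gt0.
suff r0 : (l %% n = 0)%N by rewrite (divn_eq l n) r0 addn0.
have : iter (l %% n) (turn T) (x, c, d) = (x, c, d).
  by rewrite -[RHS]fl {2}(divn_eq l n) addnC iterD perT.
move=> /(congr1 (findex (turn T) (x, c, d))).
by rewrite findex_iter ?ltn_mod // findex0.
Qed.

End HeightTheory.

(** * The units [+- t^k] and equality up to them *)

Section Monomials.

Definition monomial (u : Qt) : Prop := exists (s : bool) (k : int), u = (-1) ^+ s * tvar ^ k.

Lemma tvar_neq0 : tvar != 0.
Proof. by rewrite /tvar tofrac_eq0 polyX_eq0. Qed.

Lemma tvarD (k l : int) : tvar ^ (k + l) = tvar ^ k * tvar ^ l.
Proof. exact/expfzDr/tvar_neq0. Qed.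

Lemma tvarX_neq0 (k : int) : tvar ^ k != 0.
Proof. exact/expfz_neq0/tvar_neq0. Qed.

Lemma tvarB (k l : int) : tvar ^ (k - l) = tvar ^ k / tvar ^ l.
Proof. by apply: (mulIf (tvarX_neq0 l)); rewrite -tvarD subrK mulfVK ?tvarX_neq0. Qed.

Lemma monomialX (k : int) : monomial (tvar ^ k).
Proof. by exists false, k; rewrite expr0 mul1r. Qed.

Lemma monomial_sign (b : bool) : monomial ((-1) ^+ b).
Proof. by exists b, 0; rewrite expr0z mulr1. Qed.

Lemma monomialM u v : monomial u -> monomial v -> monomial (u * v).
Proof.
move=> [s [k ->]] [s' [k' ->]]; exists (s (+) s'), (k + k').
by rewrite tvarD signr_addb; ring.
Qed.

Lemma monomialN u : monomial u -> monomial (- u).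
Proof. by rewrite -mulN1r -(expr1 (-1)); apply/monomialM/(monomial_sign true). Qed.

Lemma monomial1 : monomial 1.
Proof. exact: (monomialX 0). Qed.

Lemma monomial_prod (I : finType) (P : pred I) (F : I -> Qt) :
  (forall i, P i -> monomial (F i)) -> monomial (\prod_(i | P i) F i).
Proof. by move=> h; elim/big_ind: _ => //; [exact: monomial1 | exact: monomialM]. Qed.

Lemma monomial_exp u n : monomial u -> monomial (u ^+ n).
Proof.
by move=> h; elim: n => [|n IH]; rewrite ?expr0 ?exprS; [exact: monomial1 | exact: monomialM].
Qed.

Lemma monomial_inv u : monomial u -> exists2 v, monomial v & v * u = 1.
Proof.
move=> [s [k ->]]; exists ((-1) ^+ s * tvar ^ (- k)); first by exists s, (- k).
by rewrite mulrACA -signr_addb addbb mul1r -tvarD addNr expr0z.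
Qed.

Lemma doteqP x y : doteq x y <-> exists2 u, monomial u & x = u * y.
Proof.
split=> [[s [k ->]]|[_ [s [k ->]] ->]]; last by exists s, k.
by exists ((-1) ^+ s * tvar ^ k) => //; exists s, k.
Qed.

Lemma doteq_refl x : doteq x x.
Proof. by apply/doteqP; exists 1; rewrite ?mul1r //; exact: monomial1. Qed.

Lemma doteq_trans y x z : doteq x y -> doteq y z -> doteq x z.
Proof.
move=> /doteqP[u mu ->] /doteqP[v mv ->]; apply/doteqP; exists (u * v); last by rewrite mulrA.
exact: monomialM.
Qed.

Lemma doteq_sym x y : doteq x y -> doteq y x.
Proof.
move=> /doteqP[u mu ->]; have [v mv vu] := monomial_inv mu.
by apply/doteqP; exists v; rewrite // mulrA vu mul1r.
Qed.

Lemma doteqM x y x' y' : doteq x y -> doteq x' y' -> doteq (x * x') (y * y').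
Proof.
move=> /doteqP[u mu ->] /doteqP[v mv ->]; apply/doteqP; exists (u * v); last by rewrite mulrACA.
exact: monomialM.
Qed.

Lemma monomial_doteq u x : monomial u -> doteq (u * x) x.
Proof. by move=> mu; apply/doteqP; exists u. Qed.

Lemma monomial_det_perm n (s : 'S_n) : monomial (\det (perm_mx s : 'M[Qt]_n)).
Proof. rewrite det_perm; exact: monomial_sign. Qed.

Lemma doteq_det_row_perm n (s : 'S_n) (A : 'M[Qt]_n) : doteq (\det (row_perm s A)) (\det A).
Proof. by rewrite row_permE det_mulmx; apply/monomial_doteq/monomial_det_perm. Qed.

Lemma doteq_det_scale n (A B : 'M[Qt]_n) (u v : 'I_n -> Qt) :
  (forall i, monomial (u i)) -> (forall j, monomial (v j)) ->
  (forall i j, A i j = u i * B i j * v j) -> doteq (\det A) (\det B).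
Proof.
move=> mu mv AE.
have -> : A = diag_mx (\row_i u i) *m B *m diag_mx (\row_j v j).
  by apply/matrixP => i j; rewrite mul_mx_diag mul_diag_mx !mxE AE.
rewrite !det_mulmx !det_diag mulrAC; apply/monomial_doteq/monomialM;
  by apply: monomial_prod => i _; rewrite mxE.
Qed.

Lemma doteq_1subX (k : int) :
  doteq (1 - tvar ^ k) (tvar ^+ `|k|%N - 1).
Proof.
case: (intP k) => [|n|n]; apply/doteqP.
- by exists 1; [exact: monomial1 | rewrite expr0z expr0 !subrr mulr0].
- exists (-1); first exact: (monomial_sign true).
  by rewrite mulN1r opprB.
exists (tvar ^ (- n.+1%:Z)); first exact: monomialX.
by rewrite abszN mulrBr mulr1 exprnP -tvarD addNr expr0z.
Qed.

End Monomials.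

(** * The chain complex *)

(** [H], [K] and [X] stand for the powers of [tvar] at the current tetrahedron, at the tail of the
    lifted face and for the crossing. Here the face is crossed in its chosen direction, in
    [incidence_head] backwards. *)
Lemma incidence_tail (F : fieldType) (H K X z u v : F) : K != 0 ->
  (1%:R * (H / K) - false%:R * z) * (u * K - v * (K * X)) = u * H - v * (H * X).
Proof. by move=> K0; rewrite /= mulr0n mulr1n; field. Qed.

Lemma incidence_head (F : fieldType) (H K X z u v : F) : K != 0 -> X != 0 ->
  (false%:R * z - 1%:R * (H * X / K)) * (v * K - u * (K / X)) = u * H - v * (H * X).
Proof. by move=> K0 X0; rewrite /= mulr0n mulr1n; field; rewrite K0 X0. Qed.

Section ChainComplex.
Variables (N : nat) (T : triangulation 'I_N) (x0 : 'I_N).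
Local Notation Tc := (Defs.cover T x0).
Local Notation pi := (pi1 T x0).
Local Notation cT := (cover_triangulation T x0).
Variables (alpha : pi -> int) (D : cell_lifts T x0) (h : Tc -> int).
Hypothesis hD : forall g p, h (deck g p) = alpha g + h p.
Hypothesis h0 : forall j, h (cell0 D j) = 0.

Local Notation cross := (crossing (cell0 D) h).
Definition base_flag (f : Tc * 'I_4) : 'I_N * 'I_4 := (cproj f.1, f.2).
Local Notation tail k := (cell1 D k).1.
Local Notation face k := (base_flag (cell1 D k)).

Lemma base_flag_flip f : base_flag (flip cT f) = flip T (base_flag f).
Proof. by case: f => p a; rewrite /base_flag /flip /= cproj_cadj. Qed.

Lemma height_flip f : h (flip cT f).1 = h f.1 + cross (base_flag f).
Proof. by case: f => p a; rewrite -(crossingE (@cell0P _ _ _ D) hD) /=; lia. Qed.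

Lemma flip_neq (f : 'I_N * 'I_4) : flip T f != f.
Proof.
case: f => x a; apply/eqP; rewrite /flip /= => -[e1 e2].
by apply: (@face_free _ T x a); split => //; apply: val_inj.
Qed.

Lemma face_unique f : exists2 k,
  f = face k \/ f = flip T (face k) &
  forall k', f = face k' \/ f = flip T (face k') -> k' = k.
Proof. by have [k [kP ku]] := cell1P D f; exists k => // k' /ku. Qed.

(* For the weights [upper] and [lower] below, the matrices C and C' of the
   header; for the weight 1, the matrix - P1. *)
Definition incidence (w : 'I_4 -> Qt) : 'M[Qt]_(N + N, N) := \matrix_(k, j)
  ((cproj (tail k) == j)%:R * w (cell1 D k).2 * tvar ^ h (tail k)
   - ((flip T (face k)).1 == j)%:R * w (flip T (face k)).2 * tvar ^ h (flip cT (cell1 D k)).1).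

Lemma P1E : P1 D alpha = - incidence (fun=> 1).
Proof.
apply/matrixP => k j; rewrite !mxE.
rewrite (@twist_sum _ _ _ _ _ hD bool [:: true; false]
  (fun b => if b then 1 else -1) (fun b => if b then (flip cT (cell1 D k)).1 else tail k)
  (cell0 D j)); last first.
  move=> g; rewrite !big_cons big_nil; case: (cell1 D k) => p a /=.
  by rewrite !(eq_sym (deck g _)); ring.
rewrite !big_cons big_nil /= h0 !subr0 cell0P !(eq_sym j) !mulr1.
rewrite -/(base_flag (flip cT _)).1.
have -> : cproj (cadj (tail k) (cell1 D k).2) = adj T (cproj (tail k)) (cell1 D k).2.
  exact: cproj_cadj.
by ring.
Qed.

Section Row.
Variable i : 'I_N.
Let start : 'I_N * 'I_4 * 'I_4 := (base_flag (cell2 D i).1, (cell2 D i).2).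
Let n := fingraph.order (turn T) start.
Let pt l := iter l (turn cT) (cell2 D i).

Lemma pt_next l : ((pt l.+1).1.1, (pt l.+1).2) = flip cT (pt l).1.
Proof. by rewrite /pt /=; case: (iter l _ _) => [[p c] d]. Qed.

Lemma pt_order : pt n = pt 0.
Proof.
rewrite /pt /n /start; have := cell2_neq D i; case: (cell2 D i) => [[p c] d] /= cd.
exact: iter_turn_order.
Qed.

Lemma P2E k : P2 D alpha i k = \sum_(0 <= l < n)
  ((base_flag (pt l).1 == face k)%:R * tvar ^ (h (pt l).1.1 - h (tail k))
   - (flip T (base_flag (pt l).1) == face k)%:R * tvar ^ (h (pt l.+1).1.1 - h (tail k))).
Proof.
rewrite !mxE.
pose q (u : nat * bool) := if u.2 then (pt u.1).1 else flip cT (pt u.1).1.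
rewrite (@twist_sum _ _ _ _ _ hD _ [seq (l, b) | l <- index_iota 0 n, b <- [:: true; false]]
  (fun u => (if u.2 then 1 else -1) * ((cell1 D k).2 == (q u).2)%:Z)
  (fun u => (q u).1) (tail k)); last first.
  move=> g.
  have -> : boundary2 D i = [seq (pt l).1 | l <- index_iota 0 n].
    by rewrite /boundary2 /pt /n /start; case: (cell2 D i) => [[p c] d] /=;
      rewrite /index_iota subn0.
  have cnt (z : Tc * 'I_4) : (count_mem z [seq (pt l).1 | l <- index_iota 0 n])%:Z
      = \sum_(0 <= l < n) ((pt l).1 == z)%:Z.
    elim: (index_iota 0 n) => [|l s IH] /=; first by rewrite big_nil.
    by rewrite big_cons PoszD IH.
  rewrite !cnt -sumrB big_allpairs_dep /=; apply: eq_bigr => l _.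
  rewrite !big_cons big_nil addr0 /= /q /=.
  have -> : ((pt l).1 == flip cT (deck1 g (cell1 D k))) = (flip cT (pt l).1 == deck1 g (cell1 D k)).
    by rewrite -{1}(@flipK _ cT (pt l).1) (inj_eq (inv_inj (@flipK _ cT))).
  rewrite /deck1; case: (pt l).1 => p c; case: (cell1 D k) => p' a /=.
  rewrite /flip /= !xpair_eqE !(eq_sym a) !(eq_sym (deck g p')).
  by do 4!case: eqP => _ //=.
rewrite big_allpairs_dep /=; apply: eq_bigr => l _.
rewrite !big_cons big_nil addr0 /= /q /=.
rewrite -base_flag_flip (_ : (pt l.+1).1.1 = (flip cT (pt l).1).1); last by rewrite -pt_next.
case: (pt l).1 => p c; rewrite /base_flag /flip /= !xpair_eqE /=.
rewrite !(eq_sym (cproj (tail k))) !(eq_sym (cell1 D k).2).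
by do 4!case: eqP => _ /=; rewrite ?mulr0n ?mulr1n; ring.
Qed.

(** Each crossing contributes the weight of the face left, minus that of the face entered in the
    next tetrahedron. A cyclic shift of the second terms, allowed by the periodicity of [pt], groups
    both by tetrahedron. *)
Lemma P2_incidence w j : (P2 D alpha *m incidence w) i j = \sum_(0 <= l < n)
  (cproj (pt l).1.1 == j)%:R * (w (pt l).1.2 - w (pt l).2) * tvar ^ h (pt l).1.1.
Proof.
rewrite mxE.
under eq_bigr => k _ do rewrite P2E mulr_suml.
rewrite exchange_big /=.
pose G l := (cproj (pt l).1.1 == j)%:R * w (pt l).2 * tvar ^ h (pt l).1.1.
have Gn : G n = G 0 by rewrite /G pt_order.
transitivity (\sum_(0 <= l < n)
    ((cproj (pt l).1.1 == j)%:R * w (pt l).1.2 * tvar ^ h (pt l).1.1 - G l.+1)).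
  apply: eq_bigr => l _.
  have nx : ((pt l.+1).1.1, (pt l.+1).2) = flip cT (pt l).1 by exact: pt_next.
  have h1 : h (pt l.+1).1.1 = h (pt l).1.1 + cross (base_flag (pt l).1).
    by rewrite -height_flip -nx.
  have G1 : G l.+1 = ((flip T (base_flag (pt l).1)).1 == j)%:R
      * w (flip T (base_flag (pt l).1)).2 * tvar ^ h (pt l.+1).1.1.
    by rewrite /G -base_flag_flip -nx.
  rewrite G1 -[cproj (pt l).1.1]/(base_flag (pt l).1).1 -[(pt l).1.2]/(base_flag (pt l).1).2.
  have [k0 k0P k0u] := face_unique (base_flag (pt l).1).
  rewrite (bigD1 k0) //= [X in _ + X]big1 ?addr0 => [|k kk0]; last first.
    have [e|_] := eqVneq (base_flag (pt l).1) (face k).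
      by move: kk0; rewrite (k0u k) ?eqxx //; left.
    have [e|_] := eqVneq (flip T (base_flag (pt l).1)) (face k).
      by move: kk0; rewrite (k0u k) ?eqxx //; right; rewrite -e flipK.
    by rewrite !mul0r subrr mul0r.
  rewrite mxE height_flip -[cproj (tail k0)]/(face k0).1 -[(cell1 D k0).2]/(face k0).2 h1.
  case: k0P => e.
    have /negbTE ne : flip T (base_flag (pt l).1) != face k0 by rewrite e flip_neq.
    rewrite ne -e eqxx; move: (cross _) => X; rewrite !tvarB !tvarD.
    apply: incidence_tail; exact: tvarX_neq0.
  have /negbTE ne : base_flag (pt l).1 != face k0 by rewrite e flip_neq.
  have fe : face k0 = flip T (base_flag (pt l).1) by rewrite e flipK.
  rewrite ne fe flipK eqxx (crossing_flip (@cell0P _ _ _ D) hD).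
  move: (cross _) => X; rewrite !tvarB !tvarD.
  by apply: incidence_head; exact: tvarX_neq0.
transitivity (\sum_(0 <= l < n)
    (cproj (pt l).1.1 == j)%:R * w (pt l).1.2 * tvar ^ h (pt l).1.1
  - \sum_(0 <= l < n) G l).
  rewrite sumrB; congr (_ - _).
  apply: (@addIr _ (G 0)); rewrite addrC -big_nat_recl // big_nat_recr //=.
  by rewrite Gn.
rewrite -sumrB; apply: eq_bigr => l _; rewrite /G; ring.
Qed.

End Row.
End ChainComplex.

(** * The torsion and the determinant of the arc matrix *)

Lemma incidence_swap (F : fieldType) (K X u v : F) : X != 0 ->
  u * K - v * (K / X) = - (K / X) * (v - u * X).
Proof. by move=> X0; field. Qed.

Lemma torsion_scale (F : fieldType) (u v w s : F) : v != 0 ->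
  u * (w * s) = s * (u / v * w) * v.
Proof. by move=> v0; field. Qed.

Section Torsion.
Variables (N : nat) (T : triangulation 'I_N) (o : 'I_N -> bool) (x0 : 'I_N).
Hypotheses (Tor : oriented T o) (Tord : ordered T).
Local Notation Tc := (Defs.cover T x0).
Local Notation pi := (pi1 T x0).
Local Notation cT := (cover_triangulation T x0).
Variables (alpha : pi -> int) (D : cell_lifts T x0) (h : Tc -> int).
Hypothesis hD : forall g p, h (deck g p) = alpha g + h p.
Hypothesis h0 : forall j, h (cell0 D j) = 0.

Local Notation cross := (crossing (cell0 D) h).
Local Notation kappa := (arc_perm Tor Tord).
Local Notation face k := (base_flag (cell1 D k)).

Definition upper (a : 'I_4) : Qt := (2 <= a)%N%:R.
Definition lower (a : 'I_4) : Qt := (a < 2)%N%:R.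

Definition arc_mx : 'M[Qt]_(N + N) := row_mx (incidence D h upper) (incidence D h lower).

Lemma arc_mxE k v : arc_mx k v =
  (flag_arc (face k) == v)%:R * tvar ^ h (cell1 D k).1
  - (flag_arc (flip T (face k)) == v)%:R * tvar ^ h (flip cT (cell1 D k)).1.
Proof.
have E (x j : 'I_N) (a : 'I_4) b : (x == j)%:R * (if b then upper a else lower a)
    = (flag_arc (x, a) == arc j b)%:R.
  rewrite /flag_arc /=.
  have -> : (arc x (2 <= a)%N == arc j b) = (x == j) && ((2 <= a)%N == b).
    apply/eqP/andP => [e|[/eqP-> /eqP->//]].
    have := congr1 (@arc_tet N) e; have := congr1 (@arc_side N) e.
    by rewrite !arc_tetK !arc_sideK => -> ->.
  rewrite /upper /lower [(a < 2)%N]ltnNge.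
  by case: b; rewrite -natrM mulnb; case: (2 <= a)%N.
rewrite -(arcK v) /arc_mx; case: (arc_side v) (arc_tet v) => j; rewrite /arc.
  by rewrite row_mxEl mxE (E _ _ _ true) (E _ _ _ true) -!surjective_pairing.
by rewrite row_mxEr mxE (E _ _ _ false) (E _ _ _ false) -!surjective_pairing.
Qed.

(** Each face has one positive side, so it is the exit of exactly one arc. Sorting the rows by that
    arc and normalizing them by units gives [cycle_mx] for the permutation of arcs, weighted by the
    crossings. *)
Lemma det_arc_mx : doteq (\det arc_mx)
  (\prod_(O in porbits kappa) (1 - tvar ^ curve_sum o cross O)).
Proof.
have /choice[s sP] (v : 'I_(N + N)) : exists k,
    arc_flag o v = face k \/ arc_flag o v = flip T (face k).
  by have [k kP _] := face_unique D (arc_flag o v); exists k.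
have s_inj : injective s.
  move=> v w e; have := sP v; have := sP w; rewrite -e.
  have pv u := positive_arc_flag o u.
  move=> h1 h2; rewrite -(arc_flagK o v) -(arc_flagK o w); congr flag_arc.
  by case: h1 => h1; case: h2 => h2; rewrite h1 h2 //; have := pv v; have := pv w;
    rewrite h1 h2 (positive_flip Tor Tord); case: (positive _ _).
pose d v := if arc_flag o v == face (s v) then tvar ^ h (cell1 D (s v)).1
            else - tvar ^ h (flip cT (cell1 D (s v))).1.
have -> : \prod_(O in porbits kappa) (1 - tvar ^ curve_sum o cross O)
    = \det (cycle_mx kappa (fun v => tvar ^ cross (arc_flag o v))).
  rewrite det_cycle_mx; apply: eq_bigr => O _; congr (1 - _).
  by rewrite /curve_sum (big_morph _ tvarD (expr0z tvar)).
apply: doteq_trans (doteq_sym (doteq_det_row_perm (perm s_inj) arc_mx)) _.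
apply: (doteq_det_scale (u := d) (v := fun=> 1)) => [v|_|v u].
- by rewrite /d; case: ifP => _; rewrite ?monomialN; try apply: monomialN; exact: monomialX.
- exact: monomial1.
rewrite mxE permE arc_mxE mulr1 mxE permE /next_arc /d.
rewrite (height_flip D hD) !(eq_sym u).
case: (eqVneq (arc_flag o v) (face (s v))) (sP v) => [e _|ne [/eqP|e]].
- by rewrite -e arc_flagK tvarD; ring.
- by rewrite (negbTE ne).
have fe : face (s v) = flip T (arc_flag o v) by rewrite e flipK.
rewrite fe flipK arc_flagK (crossing_flip (@cell0P _ _ _ D) hD).
move: (cross _) => X; rewrite tvarB.
by apply: incidence_swap; exact: tvarX_neq0.
Qed.

Lemma incidence_sum : incidence D h upper + incidence D h lower = - P1 D alpha.
Proof.
rewrite (P1E hD h0) opprK; apply/matrixP => k j; rewrite !mxE.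
have lE a : lower a = 1 - upper a.
  by rewrite /upper /lower [(a < 2)%N]ltnNge; case: (2 <= a)%N; rewrite ?subr0 ?subrr.
by rewrite !lE; ring.
Qed.

Lemma P2_P1 : P2 D alpha *m P1 D alpha = 0.
Proof.
rewrite (P1E hD h0) mulmxN; apply/eqP; rewrite oppr_eq0; apply/eqP/matrixP => i j.
by rewrite (P2_incidence D hD) mxE big1_seq // => l _; rewrite subrr mulr0 mul0r.
Qed.

(** Multiplying [col_mx P2 b] by [(C | P1)] gives a block triangular matrix because [P2 P1 = 0], and
    [(C | P1)] comes from [(C | C')] by column operations of determinant [+-1]. *)
Lemma det_P2_incidence Delta : is_alexander D alpha Delta ->
  doteq (\det (P2 D alpha *m incidence D h upper))
    (Delta / (tvar - 1) * \prod_(O in porbits kappa) (1 - tvar ^ curve_sum o cross O)).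
Proof.
case=> b [_ b0 tors].
apply: doteq_trans (doteqM (doteq_sym tors) det_arc_mx).
have E1 : col_mx (P2 D alpha) b *m row_mx (incidence D h upper) (P1 D alpha)
  = block_mx (P2 D alpha *m incidence D h upper) 0 (b *m incidence D h upper) (b *m P1 D alpha).
  by rewrite mul_col_row P2_P1.
have E2 : arc_mx *m block_mx 1%:M (- 1%:M) 0 (- 1%:M)
    = row_mx (incidence D h upper) (P1 D alpha).
  rewrite /arc_mx mul_row_block !mulmx1 !mulmxN !mulmx1 mulmx0 addr0; congr (row_mx _ _).
  by rewrite -opprD incidence_sum opprK.
have d2 : \det (row_mx (incidence D h upper) (P1 D alpha)) = \det arc_mx * (-1) ^+ N.
  rewrite -E2 det_mulmx det_ublock det1 mul1r; congr (_ * _).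
  by rewrite -scaleN1r detZ det1 mulr1.
have := congr1 determinant E1; rewrite det_mulmx det_lblock d2 => E3.
have -> : \det (P2 D alpha *m incidence D h upper)
    = (-1) ^+ N * (\det (col_mx (P2 D alpha) b) / \det (b *m P1 D alpha) * \det arc_mx).
  by apply: (mulIf b0); rewrite -E3; exact: torsion_scale.
by apply/monomial_doteq/monomial_exp/(monomial_sign true).
Qed.

End Torsion.

(** * The Neumann-Zagier matrix *)

Section NeumannZagier.
Variables (N : nat) (T : triangulation 'I_N) (o : 'I_N -> bool) (x0 : 'I_N).
Hypotheses (Tor : oriented T o) (Tord : ordered T).
Local Notation Tc := (Defs.cover T x0).
Local Notation pi := (pi1 T x0).
Local Notation cT := (cover_triangulation T x0).

(* Distinguishes the two directions of rotation around an edge. *)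
Definition turn_sign (f : 'I_N * 'I_4 * 'I_4) : bool :=
  ~~ (odd f.1.2 (+) odd f.2 (+) (f.1.2 < f.2)%N) == o f.1.1.

Lemma turn_sign_turn f : f.1.2 != f.2 -> turn_sign (turn T f) = turn_sign f.
Proof.
case: f => [[x c] d] /= cd; have [k -> _] := unlift_some cd.
rewrite /turn_sign /= gperm_lift //.
have := positive_flip Tor Tord (x, c); rewrite /positive /flip /=.
move: (adj T x c) (gperm T x c c) => y b; clear.
case: (o x); case: (o y); elim/ord4_ind: b; elim/ord4_ind: c => // _; by elim/ord3_ind: k.
Qed.

Lemma turn_neq f : f.1.2 != f.2 -> (turn T f).1.2 != (turn T f).2.
Proof. by case: f => [[x c] d] /=; rewrite (inj_eq perm_inj) eq_sym. Qed.

Lemma turn_sign_iter f l : f.1.2 != f.2 ->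
  (iter l (turn T) f).1.2 != (iter l (turn T) f).2 /\ turn_sign (iter l (turn T) f) = turn_sign f.
Proof.
by move=> ne; elim: l => //= l [ne' <-]; rewrite turn_neq ?turn_sign_turn.
Qed.

Lemma turn_sign_swap x c d : c != d -> turn_sign (x, d, c) = ~~ turn_sign (x, c, d).
Proof.
rewrite /turn_sign /=; case: (o x); elim/ord4_ind: c; elim/ord4_ind: d => //.
Qed.

Definition shape_diff (s : bool) (c d : 'I_4) : int :=
  (has_shape s Shape_z'' (~: [set c; d]))%:Z - (has_shape s Shape_z' (~: [set c; d]))%:Z.

Lemma set2_eq (c d a b : 'I_4) : ([set c; d] == [set a; b])
  = (c == a) && (d == b) || (c == b) && (d == a) || [&& c == d, a == b & c == a].
Proof.
have E (p q : {set 'I_4}) : (p == q) = [&& (ord4 0 \in p) == (ord4 0 \in q),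
   (ord4 1 \in p) == (ord4 1 \in q), (ord4 2 \in p) == (ord4 2 \in q)
   & (ord4 3 \in p) == (ord4 3 \in q)].
  apply/eqP/and4P => [->//|[/eqP e0 /eqP e1 /eqP e2 /eqP e3]].
  by apply/setP; elim/ord4_ind.
rewrite E !inE.
by elim/ord4_ind: c; elim/ord4_ind: d; elim/ord4_ind: a; elim/ord4_ind: b.
Qed.

(** The edges with parameter [z] are 01 and 23, whose adjacent faces have equal [upper]. On the
    other edges [upper] jumps, and the direction of rotation makes the jump tell [z''] from [z']:
    this is why the weight [upper] produces [B]. *)
Lemma upper_sub x c d : c != d ->
  upper c - upper d = - (-1) ^+ (~~ turn_sign (x, c, d)) * (shape_diff (o x) c d)%:~R.
Proof.
move=> cd; rewrite /shape_diff /has_shape !(inj_eq (@setC_inj _)) !(can2_eq (@setCK _) (@setCK _)).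
have C2 : ~: [set ord0; @Ordinal 4 2 isT] = [set ord4 1; ord4 3].
  by apply/setP; elim/ord4_ind; rewrite !inE.
have C3 : ~: [set ord0; @Ordinal 4 3 isT] = [set ord4 1; ord4 2].
  by apply/setP; elim/ord4_ind; rewrite !inE.
rewrite /turn_sign /=; case: (o x) => /=; rewrite C2 C3 !set2_eq.
  by move: cd; elim/ord4_ind: c; elim/ord4_ind: d => //= _;
    rewrite /upper /= ?expr0 ?expr1; ring.
by move: cd; elim/ord4_ind: c; elim/ord4_ind: d => //= _;
  rewrite /upper /= ?expr0 ?expr1; ring.
Qed.

Lemma same_edge_iter (X : Type) (S : triangulation X) (f : X * 'I_4 * 'I_4) l :
  same_edge S (turn_edge f) (turn_edge (iter l (turn S) f)).
Proof.
elim: l => [|l IH]; first exact: rst_refl.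
apply: (rst_trans _ _ _ _ _ IH); apply: rst_step; rewrite iterS.
case: (iter l _ f) => [[x c] d].
have cd : c \notin ~: [set c; d] by rewrite !inE eqxx.
by have := EdgeGlue S x cd; rewrite imset_setC2 (finset.setUC [set gperm S x c c]).
Qed.

Lemma same_edge_lift u v (p : Tc) : same_edge T u v -> cproj p = u.1 ->
  exists2 q : Tc, cproj q = v.1 & same_edge cT (p, u.2) (q, v.2).
Proof.
move=> uv; pose Q u v := forall p : Tc, cproj p = u.1 ->
  exists2 q : Tc, cproj q = v.1 & same_edge cT (p, u.2) (q, v.2).
suff [+ _] : Q u v /\ Q v u by apply.
have glue a b : edge_glue T a b -> Q a b.
  case=> x c e ce r /= rx; exists (cadj r c); first by rewrite cproj_cadj rx.
  by apply: rst_step; have := @EdgeGlue _ cT r c e ce; rewrite /= /cgperm rx.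
elim: uv => {u v p} [a b ab|a|a b _ [? ?]|a b d _ [ab ba] _ [bd db]].
- by split; apply: glue => //; exact: edge_glue_sym.
- by split=> r re; exists r => //; exact: rst_refl.
- by split.
split=> r re.
  have [s se rs] := ab r re; have [t te st] := bd s se.
  by exists t => //; exact: rst_trans rs st.
have [s se rs] := db r re; have [t te st] := ba s se.
by exists t => //; exact: rst_trans rs st.
Qed.

Lemma same_edge_deck (g : pi) u v : same_edge cT u v ->
  same_edge cT (deck g u.1, u.2) (deck g v.1, v.2).
Proof.
elim=> {u v} [a b|a|a b _|a b c _ H1 _].
- case=> p a' e ae; apply: rst_step; rewrite /=.
  by have := @EdgeGlue _ cT (deck g p) a' e ae; rewrite /= /cgperm cproj_deck cadj_deck.
- exact: rst_refl.
- exact: rst_sym.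
- exact: rst_trans.
Qed.

Definition deck_flag (g : pi) (f : Tc * 'I_4 * 'I_4) := (deck g f.1.1, f.1.2, f.2).

Lemma iter_turn_deck g f l :
  iter l (turn cT) (deck_flag g f) = deck_flag g (iter l (turn cT) f).
Proof.
elim: l => //= l ->; case: (iter l _ f) => [[p c] d].
by rewrite /deck_flag /= /cgperm cproj_deck cadj_deck.
Qed.

Variable L : lifts T x0.

Section Row.
Variables (f : Tc * 'I_4 * 'I_4) (i : 'I_N).
Hypotheses (f_neq : f.1.2 != f.2) (f_edge : same_edge cT (turn_edge f) (edge_lift L i)).
Let f0 : 'I_N * 'I_4 * 'I_4 := (cproj f.1.1, f.1.2, f.2).
Let n := fingraph.order (turn T) f0.
Let pt l := iter l (turn cT) f.

Lemma base_turn_row l : (cproj (pt l).1.1, (pt l).1.2, (pt l).2) = iter l (turn T) f0.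
Proof. by rewrite /pt /f0; case: f => [[p c] d]; exact: iter_cturn_proj. Qed.

(** Meeting an edge twice would give the same triple, excluded below the order [n], or the triple
    with its faces exchanged, excluded by the constancy of [turn_sign]. So edges can be counted by
    turns. *)
Lemma turn_edge_row_inj l m : (l < n)%N -> (m < n)%N ->
  turn_edge (pt l) = turn_edge (pt m) -> l = m.
Proof.
move=> ln mn; have := turn_sign_iter (f := f0) m f_neq; have := turn_sign_iter (f := f0) l f_neq.
have := base_turn_row l; have := base_turn_row m.
case: (pt l) => [[p c] d]; case: (pt m) => [[p' c'] d'] /= em el.
rewrite -em -el /turn_edge /= => -[cd s] [cd' s'] [pp] /setC_inj/eqP; subst p'.
rewrite set2_eq (negbTE cd) /= orbF => /orP[]/andP[/eqP ec /eqP ed]; subst c' d'.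
  have := el; rewrite em => /(congr1 (findex (turn T) f0)).
  by rewrite !findex_iter.
by move: s'; rewrite turn_sign_swap // s; case: (turn_sign f0).
Qed.

Lemma nz_countE s (g : pi) j : nz_count o L s g i j = \sum_(0 <= l < n)
  (has_shape (o j) s (~: [set (pt l).1.2; (pt l).2]) && (deck g (tet_lift L j) == (pt l).1.1))%:Z.
Proof.
pose P := [set l : 'I_n | has_shape (o j) s (turn_edge (pt l)).2
  && (deck g (tet_lift L j) == (turn_edge (pt l)).1)].
rewrite mxE (_ : [set e | _] = [set (turn_edge (pt (val l))).2 | l in P]); last first.
  apply/setP => e; rewrite !inE; apply/andP/imsetP.
    case=> he /asboolP se; have := rst_trans _ _ _ _ _ f_edge (rst_sym _ _ _ _ se).
    rewrite [f]surjective_pairing [f.1]surjective_pairing.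
    case/same_edge_turn => // l ln pe.
    have {}pe : turn_edge (pt l) = (deck g (tet_lift L j), e).
      by rewrite pe /pt -!surjective_pairing.
    by exists (Ordinal ln); rewrite ?inE [turn_edge _]pe //= he eqxx.
  case=> l; rewrite inE => /andP[hs /eqP ge] ->; split=> //.
  apply/asboolP; apply: rst_trans f_edge; apply: rst_sym.
  by rewrite ge -surjective_pairing; exact: same_edge_iter.
rewrite card_in_imset => [|l m]; last first.
  rewrite !inE => /andP[_ /eqP gl] /andP[_ /eqP gm] e; apply: val_inj.
  apply: (turn_edge_row_inj (ltn_ord l) (ltn_ord m)).
  by rewrite [LHS]surjective_pairing [RHS]surjective_pairing e -gl -gm.
rewrite big_mkord -sum1_card big_mkcond /=.
rewrite (big_morph Posz PoszD (erefl _)).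
by apply: eq_bigr => l _; rewrite inE; case: (_ && _).
Qed.

Lemma twisted_nzE (g : pi) j : twisted_nz o L i j g = \sum_(0 <= l < n)
  shape_diff (o j) (pt l).1.2 (pt l).2 * (deck g (tet_lift L j) == (pt l).1.1)%:Z.
Proof.
rewrite mxE !nz_countE -sumrB; apply: eq_bigr => l _; rewrite /shape_diff.
by case: (deck g _ == _); rewrite ?andbT ?andbF ?mulr1 // mulr0 subrr.
Qed.

Variables (alpha : pi -> int) (h : Tc -> int).
Hypothesis hD : forall g p, h (deck g p) = alpha g + h p.

Lemma twist_nzE j : map_mx (twist alpha) (twisted_nz o L) i j =
  - (-1) ^+ (~~ turn_sign f0) * \sum_(0 <= l < n)
    (cproj (pt l).1.1 == j)%:R * (upper (pt l).1.2 - upper (pt l).2)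
      * tvar ^ (h (pt l).1.1 - h (tet_lift L j)).
Proof.
rewrite mxE (twist_sum hD (s := index_iota 0 n) (p := tet_lift L j) (q := fun l => (pt l).1.1)
  (n := fun l => shape_diff (o j) (pt l).1.2 (pt l).2)); last by move=> g; exact: twisted_nzE.
rewrite mulr_sumr; apply: eq_bigr => l _; rewrite tet_liftP eq_sym.
have [<-|_] := eqVneq (cproj (pt l).1.1) j; last by rewrite !(mulr0, mul0r).
have := turn_sign_iter (f := f0) l f_neq; rewrite -base_turn_row /= => -[ne <-].
rewrite (upper_sub (cproj (pt l).1.1)) // mulr1 mul1r !mulrA.
by rewrite mulrNN -signr_addb addbb mul1r.
Qed.
End Row.

Variables (alpha : pi -> int) (D : cell_lifts T x0) (h : Tc -> int).
Hypothesis hD : forall g p, h (deck g p) = alpha g + h p.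

(** The lifts in [L] and [D] are chosen independently. Matching them permutes the rows and
    multiplies rows and columns by units, among them the sign of the rotation of each 2-cell. *)
Lemma det_twisted_nz : doteq (\det (map_mx (twist alpha) (twisted_nz o L)))
  (\det (P2 D alpha *m incidence D h upper)).
Proof.
have [cell2_card cell2_uniq] := cell2P D; have [_ edge_uniq] := edge_liftP L.
pose bedge i : 'I_N * {set 'I_4} :=
  (cproj (cell2 D i).1.1, ~: [set (cell2 D i).1.2; (cell2 D i).2]).
(* [r i] consists of the row of [L] for the edge dual to the 2-cell [i] and of a deck transformation
   matching the two lifts. *)
have /choice[r rP] (i : 'I_N) : exists u : 'I_N * pi,
    same_edge T (cproj (edge_lift L u.1).1, (edge_lift L u.1).2) (bedge i) /\
    same_edge cT (turn_edge (deck_flag u.2 (cell2 D i))) (edge_lift L u.1).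
  have [k [kP _]] := edge_uniq (bedge i).1 (bedge i).2 (cell2_card i).
  have [//|q /= qk pq] := same_edge_lift (p := (cell2 D i).1.1) (rst_sym _ _ _ _ kP).
  have [g gq] := deck_transitive qk; exists (k, g); split => //=.
  by have := same_edge_deck g pq; rewrite /= gq -surjective_pairing.
have r_inj : injective (fun i => (r i).1).
  move=> i j /= e; have [ri _] := rP i; have [rj _] := rP j; rewrite -e in rj.
  have [k [_ ku]] := cell2_uniq (bedge i).1 (bedge i).2 (cell2_card i).
  rewrite -(ku i); last exact: rst_refl.
  by apply: ku; exact: rst_trans (rst_sym _ _ _ _ rj) ri.
apply: doteq_trans (doteq_sym (doteq_det_row_perm (perm r_inj) _)) _.
pose sg i := turn_sign (cproj (cell2 D i).1.1, (cell2 D i).1.2, (cell2 D i).2).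
apply: (doteq_det_scale (u := fun i => - (-1) ^+ (~~ sg i) * tvar ^ alpha (r i).2)
  (v := fun j => tvar ^ (- h (tet_lift L j)))) => [i|j|i j].
- by apply: monomialM; [apply/monomialN/monomial_sign | exact: monomialX].
- exact: monomialX.
have [_ se] := rP i.
rewrite [LHS]mxE permE (twist_nzE (f := deck_flag (r i).2 (cell2 D i)) (cell2_neq D i) se hD) /=.
rewrite (P2_incidence D hD).
rewrite /sg cproj_deck mulr_sumr mulr_suml; rewrite mulr_sumr; apply: eq_bigr => l _.
rewrite iter_turn_deck /= cproj_deck hD !tvarD.
by ring.
Qed.
End NeumannZagier.

Theorem theorem3p1 (N : nat) (T : triangulation 'I_N) (o : 'I_N -> bool)
    (x0 : 'I_N) (alpha : pi1 T x0 -> int)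
    (L : lifts T x0) (D : cell_lifts T x0) (Delta : Qt) :
  connected T -> oriented T o -> torus_link T -> ordered T ->
  {morph alpha : g h / (g * h)%g >-> g + h} ->
  acyclic D alpha -> is_alexander D alpha Delta ->
  let detB := \det (map_mx (twist alpha) (twisted_nz o L)) in
  detB = 0 \/
  exists n m : nat, (1 <= m)%N /\
    doteq detB (Delta / (tvar - 1) * (tvar ^+ n - 1) ^+ m).
Proof.
move=> _ Tor Tlink Tord alphaM _ alex detB; rewrite /detB {detB}.
have [h [hD h0]] := height_exists alphaM (@cell0P _ _ _ D).
pose cross := crossing (cell0 D) h; pose kappa := arc_perm Tor Tord.
have E := doteq_trans (det_twisted_nz Tor Tord L D hD) (det_P2_incidence Tor Tord hD h0 alex).
have [->|B0] := eqVneq (\det (map_mx (twist alpha) (twisted_nz o L))) 0; [by left | right].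
(* A curve with zero sum would contribute the factor [1 - t^0 = 0]. *)
have sum0 O : O \in porbits kappa -> curve_sum o cross O != 0.
  move=> Ok; apply: contra B0 => /eqP e; have /doteqP[u _ ->] := E.
  by rewrite (bigD1 O) //= e expr0z subrr mul0r !mulr0.
have c_flip := crossing_flip (@cell0P _ _ _ D) hD.
have c_turn := crossing_turn (@cell0P _ _ _ D) hD.
have abs := curve_sum_absz Tlink c_flip c_turn sum0.
pose O0 := porbit kappa (lshift N x0).
have O0P : O0 \in porbits kappa by apply/imsetP; exists (lshift N x0).
(* [n] is the common absolute value of the curve sums, [m] the number of curves, positive because
   [x0] provides an arc. *)
exists `|curve_sum o cross O0|%N, #|porbits kappa|; split.
  by apply/card_gt0P; exists O0.
apply: doteq_trans E (doteqM (doteq_refl _) _).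
rewrite -prodr_const; apply: (big_rec2 doteq); first exact: doteq_refl.
move=> O y z OP; apply: doteqM; rewrite -(abs O O0) //.
exact: doteq_1subX.
Qed.
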